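(* Let $T_0:[0,1]\to[0,1]$ be Borel measurable and $\rho$ a Lipschitz probability density on $\mathbb R$ supported on $[-1,1]$. Suppose the transfer operator $L_0f(x)=\int k_0(x,y)f(y)\,dy$ on $L^2$, with kernel $k_0(x,y)=(P_\pi\tau_{-T_0(y)}\rho)(x)$, satisfies (A1): $\lim_{n\to\infty}\|L_0^ng\|_2=0$ for every $g\in V$. Let $\ell\ge0$ and $c\in\mathrm{span}\{f_0\}^\perp$, and suppose there is $F'\subset\widetilde F_\ell$ with $m(F')>0$ such that $f_0(y)>0$ and $(\mathrm{Id}-L_0^* )^{-1}c\notin\mathrm{span}\{\mathcal P(\cdot,y)\}^\perp$ for all $y\in F'$. Let $\mathcal G:L^2\to L^2$ be defined by $$\mathcal Gf(y):=\int_0^1\left(P_\pi\left(\tau_{-T_0(y)}\frac{d\rho}{dx}\right)\right)(x)f(x)\,dx.$$ Then the problem $$\min_{\dot T\in S_{T_0,\ell}}-\langle c,\widehat R(\dot T)\rangle_{L^2([0,1],\mathbb R)}\quad\text{subject to}\quad\|\dot T\|_2^2-1=0$$ has the unique solution $$\dot T(y)=\begin{cases}-\dfrac{f_0(y)\,\mathcal G((\mathrm{Id}-L_0^* )^{-1}c)(y)}{\|f_0\,\mathcal G((\mathrm{Id}-L_0^* )^{-1}c)\mathbf 1_{\widetilde F_\ell}\|_2}&y\in\widetilde F_\ell,\\[2mm]0&\text{otherwise}.\end{cases}$$ Furthermore, $\dot T\in L^\infty$.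
   Context: $L^p=L^p([0,1],\mathbb R)$ with Lebesgue measure $m$; $V:=\{f\in L^2:\int f\,dm=0\}$. $(\tau_bg)(x):=g(x+b)$; $P_\pi f(x):=\sum_{i\in2\mathbb Z}(f(i+x)+f(i-x))$ for $x\in[0,1]$. $d\rho/dx$ is the a.e. derivative and $\mathcal P(x,y):=\left(P_\pi\left(\tau_{-T_0(y)}\frac{d\rho}{dx}\right)\right)(x)$. $f_0$ is the unique function in $L^2$ with $L_0f_0=f_0$ and $\int f_0\,dm=1$. $$\widehat R(\dot T):=-(\mathrm{Id}-L_0)^{-1}\int_0^1\mathcal P(\cdot,y)\,\dot T(y)f_0(y)\,dy,$$ where $(\mathrm{Id}-L_0)^{-1}:V\to V$ is the bounded inverse of $\mathrm{Id}-L_0$ on $V$ (the integral lies in $V$). $L_0^*$ is the $L^2$ adjoint and $(\mathrm{Id}-L_0^* )^{-1}$ is the bounded inverse of $\mathrm{Id}-L_0^*$ on $\mathrm{span}\{f_0\}^\perp\subset L^2$. $\widetilde F_\ell:=\{x\in[0,1]:\ell\le T_0(x)\le1-\ell\}$; $S_{T_0,\ell}:=\{T\in L^2:\mathrm{supp}(T)\subseteq\widetilde F_\ell\}$ (i.e. $T=0$ a.e. outside $\widetilde F_\ell$). *)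

(* Defs.v *)
From HB Require Import structures.
From mathcomp Require Import all_boot all_order all_algebra.
From mathcomp Require Import all_classical all_reals all_analysis.

Set Implicit Arguments.
Unset Strict Implicit.
Unset Printing Implicit Defensive.
Import Order.TTheory GRing.Theory Num.Theory.
Import numFieldNormedType.Exports.

Local Open Scope classical_set_scope.
Local Open Scope ring_scope.

Lemma lebesgue_measure01_lty (R : realType) :
  (@lebesgue_measure R `[0%R, 1%R]%classic < +oo)%E.
Proof. by rewrite lebesgue_measure_itv/= lte01 oppr0 adde0 ltry. Qed.

(* Lebesgue measure on [0,1], as a measure on R concentrated on [0,1]. Elements
   of L^p([0,1]) are thus represented by functions R -> R, whose values outside
   [0,1] are irrelevant, and equality in L^p is [f = g %[ae leb01 R]]. *)
Definition leb01 (R : realType) : {finite_measure set (measurableTypeR R) -> \bar R} :=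
  @mfrestr _ (measurableTypeR R) _ _ (@lebesgue_measure R)
    (measurable_itv `[0%R, 1%R]) (lebesgue_measure01_lty R).

Section L2.
Context {R : realType}.
Implicit Types (f g u v : R -> R) (A : (R -> R) -> R -> R) (W : set (R -> R)).

Definition L2 : set (R -> R) := [set f | f \in Lfun (leb01 R) 2%:E].

Definition norm2 f : R := fine ('N[leb01 R]_(2%:E)[EFin \o f])%E.

Definition inner f g : R := \int[leb01 R]_x (f x * g x).

Definition V : set (R -> R) := [set f | L2 f /\ \int[leb01 R]_x f x = 0].

Definition span1 f : set (R -> R) := [set g | exists a : R, g = a \*o f].

Definition perp W : set (R -> R) :=
  [set g | L2 g /\ forall h, W h -> inner g h = 0].

(* a representative of the value at [g] of the adjoint of [A] *)
Definition adjoint A g : R -> R :=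
  xget (cst 0) [set h | L2 h /\ forall f, L2 f -> inner (A f) g = inner f h].

(* a representative of the value at [v] of (Id - A)^-1 : W -> W; junk unless
   [v] is in [W] and Id - A is bijective on [W] modulo a.e. equality *)
Definition inv_id_sub W A v : R -> R :=
  xget (cst 0) [set u | W u /\ u \- A u = v %[ae leb01 R]].

(* The sum over 2Z is a finitely supported sum: it is meant for [f] vanishing
   outside a bounded set. *)
Definition P_pi f (x : R) : R :=
  \sum_(i \in [set i : int | (2 %| i)%Z]) (f (i%:~R + x) + f (i%:~R - x)).

Definition translate (b : R) g (x : R) : R := g (x + b).

(* a version of the a.e. derivative: 0 where [f] is not differentiable, so that
   it vanishes outside [-1,1] when [f] does *)
Definition ae_derivative f (x : R) : R :=
  if `[< derivable f x 1 >] then derive1 f x else 0.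

Definition is_minimizer W (J : (R -> R) -> R) f : Prop :=
  W f /\ forall g, W g -> J f <= J g.

End L2.

Section System.
Context {R : realType}.
Variables (T0 rho : R -> R).
Implicit Types (f T c : R -> R).

Definition k0 (x y : R) : R := P_pi (translate (- T0 y) rho) x.

Definition L0 f (x : R) : R := \int[leb01 R]_y (k0 x y * f y).

Definition kerP (x y : R) : R :=
  P_pi (translate (- T0 y) (ae_derivative rho)) x.

Definition calG f (y : R) : R := \int[leb01 R]_x (kerP x y * f x).

Definition Rhat (f0 : R -> R) T : R -> R :=
  \- inv_id_sub V L0 (fun x => \int[leb01 R]_y (kerP x y * T y * f0 y)).

Definition inv_id_sub_adjoint (f0 : R -> R) : (R -> R) -> R -> R :=
  inv_id_sub (perp (span1 f0)) (adjoint L0).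

Definition Ftilde (l : R) : set R :=
  [set x | 0 <= x <= 1 /\ l <= T0 x <= 1 - l].

Definition S_T0 (l : R) : set (R -> R) :=
  [set T | L2 T /\ {ae leb01 R, forall x, ~ Ftilde l x -> T x = 0}].

Definition feasible (l : R) : set (R -> R) :=
  [set T | S_T0 l T /\ norm2 T ^+ 2 - 1 = 0].

Definition objective (f0 : R -> R) c T : R := - inner c (Rhat f0 T).

Definition Topt (l : R) (f0 : R -> R) c (y : R) : R :=
  let h := f0 \* calG (inv_id_sub_adjoint f0 c) in
  if y \in Ftilde l then - (h y / norm2 (h \* \1_(Ftilde l))) else 0.

End System.

(* Main.v *)
Require Import Defs.
From HB Require Import structures.
From mathcomp Require Import all_boot all_order all_algebra.
From mathcomp Require Import all_classical all_reals all_analysis.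
From mathcomp Require Import measurable_realfun ess_sup_inf.
From mathcomp Require Import zify ring lra.

Set Implicit Arguments.
Unset Strict Implicit.
Unset Printing Implicit Defensive.
Import Order.TTheory GRing.Theory Num.Theory.
Import numFieldNormedType.Exports.

Local Open Scope classical_set_scope.
Local Open Scope ring_scope.

(* Put w = (Id - L_0^* )^-1 c and h = f_0 * G w. Solving u - L_0 u = v in V for
   the perturbation v of T, duality and Fubini turn the objective into the linear
   form <h, T>, which on the unit sphere of the functions vanishing off Ftilde is
   minimized exactly at -h 1_Ftilde normalized.

   The solvability of u - L_0 u = v has to be derived from (A1). L_0 is a
   contraction of L^1 with a bounded kernel which is Lipschitz in x, so that it is
   uniformly approximated by finite rank operators; together with the strong
   convergence (A1) this makes some power of L_0 a strict L^1-contraction on V.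
   The Neumann series then converges pointwise, because L_0 maps L^1 to L^oo.
   That v has mean zero is the identity \int rho' = 0, which rests on the
   fundamental theorem of calculus for Lipschitz functions: up to an affine change,
   such a function is monotone and its Stieltjes measure has a density with respect
   to Lebesgue measure by Radon-Nikodym. *)

(** * Bounded kernels on a finite measure space *)

(** The contraction is sought in L^1 because a Markov kernel has norm at most 1 there, a bound that
    can fail in L^2; (A1) still applies, since on a space of mass 1 the L^2 norm dominates the L^1
    norm. (A1) gives neither a rate nor uniformity in [g]: finite rank approximation reduces it to
    finitely many test functions, for which one common [n] suffices. The other obstacle is
    representation. Elements of L^2([0,1]) are functions on the whole line and [T0] is arbitrary off
    [0,1], so the integrands of [L0] and [calG] need not be measurable. They are replaced by the
    cut-off kernels [ker01], which agree with them on [0,1]^2. Inverses and adjoints are arbitrary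
    choices among representatives: the argument relies only on the equations they satisfy, once the
    set chosen from is known to be nonempty. *)

Section kernel_operator.
Context d (T : measurableType d) (R : realType).
Variable mu : {finite_measure set T -> \bar R}.
Implicit Types (f g : T -> R) (q : T -> T -> R).

Definition kernel_op q f (x : T) : R := \int[mu]_y (q x y * f y).

Definition norm1 f : R := \int[mu]_x `|f x|.

Definition bounded_kernel (K : R) q :=
  measurable_fun setT (fun z : T * T => q z.1 z.2) /\ forall x y, `|q x y| <= K.

Lemma bounded_kernel_swap K q : bounded_kernel K q ->
  bounded_kernel K (fun x y => q y x).
Proof.
move=> [mq qK]; split => //.
exact: (measurableT_comp mq (@measurable_swap _ _ T T)).
Qed.

Lemma bounded_integrable (M : R) f : measurable_fun setT f ->
  (forall x, `|f x| <= M) -> mu.-integrable setT (EFin \o f).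
Proof.
move=> mf fM; apply: measurable_bounded_integrable => //.
  by rewrite ltey_eq fin_num_measure.
by exists M; split; [exact: num_real|move=> N MN x _ /=; rewrite (le_trans (fM x))// ltW].
Qed.

Lemma integrableRZl a f : mu.-integrable setT (EFin \o f) ->
  mu.-integrable setT (EFin \o (fun x => a * f x)).
Proof. by move=> intf; have := integrableZl measurableT a intf. Qed.

Lemma norm1E f : mu.-integrable setT (EFin \o f) ->
  (\int[mu]_x `|(f x)%:E| = (norm1 f)%:E)%E.
Proof.
move=> intf; rewrite /norm1 /Rintegral fineK//.
by have := integrable_fin_num measurableT (integrable_norm intf).
Qed.

Lemma integrable_mul_bounded (M : R) f g : measurable_fun setT g ->
  (forall x, `|g x| <= M) -> mu.-integrable setT (EFin \o f) ->
  mu.-integrable setT (EFin \o (fun x => g x * f x)).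
Proof.
move=> mg gM intf.
apply: (@integrableMr _ _ _ mu setT measurableT g (EFin \o f)) => //.
by exists M; split; [exact: num_real|move=> N MN x _ /=; rewrite (le_trans (gM x))// ltW].
Qed.

Section bounded_kernel.
Context (K : R) q (bq : bounded_kernel K q).

Let mq : measurable_fun setT (fun z : T * T => q z.1 z.2). Proof. by case: bq. Qed.
Let qK x y : `|q x y| <= K. Proof. by case: bq. Qed.

Lemma integrable_kernel x f : mu.-integrable setT (EFin \o f) ->
  mu.-integrable setT (EFin \o (fun y => q x y * f y)).
Proof.
apply: (@integrable_mul_bounded K) => //.
exact: (measurableT_comp mq (pair1_measurable x)).
Qed.

(** Tonelli: the inner integral of the absolute value is at most [K * norm1 f] times the absolute
    value of [g x]. The weight [g] serves [kernel_op_swap]; with [g = 1] the lemma yields the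
    measurability of [kernel_op q f]. *)
Lemma integrable_kernel2 f g : mu.-integrable setT (EFin \o f) ->
  mu.-integrable setT (EFin \o g) ->
  (mu \x mu)%E.-integrable setT (EFin \o (fun z : T * T => g z.1 * (q z.1 z.2 * f z.2))).
Proof.
move=> intf intg.
have /measurable_EFinP mf := measurable_int _ intf.
have /measurable_EFinP mg := measurable_int _ intg.
have mF : measurable_fun setT (fun z : T * T => g z.1 * (q z.1 z.2 * f z.2)).
  apply: measurable_funM; first exact: measurableT_comp.
  by apply: measurable_funM => //; exact: measurableT_comp.
apply/integrable12ltyP; first exact/measurable_EFinP.
have intfn : mu.-integrable setT (EFin \o (fun y => `|f y|)) by exact: integrable_norm.
have intgn : mu.-integrable setT (EFin \o (fun y => `|g y|)) by exact: integrable_norm.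
pose C := K * norm1 f.
have intgC : mu.-integrable setT (EFin \o (fun x => C * `|g x|)) by exact: integrableRZl.
have mE : measurable_fun setT (fun z : T * T => `|(g z.1 * (q z.1 z.2 * f z.2))%:E|%E).
  by apply: measurableT_comp => //; exact/measurable_EFinP.
apply: (@le_lt_trans _ _ (\int[mu]_x (C * `|g x|)%:E)%E); last first.
  by rewrite ltey_eq; apply/orP; left; have := integrable_fin_num measurableT intgC.
apply: ge0_le_integral => //.
- by move=> x _; apply: integral_ge0.
- by have := measurable_fun_fubini_tonelli_F (m2 := mu) _ mE; apply.
- exact: measurable_int intgC.
move=> x _ /=.
have inth : mu.-integrable setT (EFin \o (fun y => g x * (q x y * f y))).
  exact/integrableRZl/integrable_kernel.
rewrite norm1E// lee_fin /C mulrC mulrA /norm1 -RintegralZl//.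
apply: le_Rintegral => //.
- exact: (integrable_norm inth).
- exact: integrableRZl.
- by move=> y _; rewrite !normrM -mulrA ler_wpM2l// ler_wpM2r.
Qed.

Lemma measurable_kernel_op f : mu.-integrable setT (EFin \o f) ->
  measurable_fun setT (kernel_op q f).
Proof.
move=> intf; have int1 : mu.-integrable setT (EFin \o (fun=> 1)).
  by apply: (@bounded_integrable 1) => // x; rewrite normr1.
have := measurable_fubini_F (integrable_kernel2 intf int1).
rewrite /fubini_F /= => mF; apply: (@measurableT_comp _ _ _ _ _ _ fine) => //.
under eq_fun do under eq_integral do rewrite -[q _ _ * _]mul1r.
exact: mF.
Qed.

Lemma kernel_op_bound f x : mu.-integrable setT (EFin \o f) ->
  `|kernel_op q f x| <= K * norm1 f.
Proof.
move=> intf; rewrite /kernel_op.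
apply: le_trans (le_normr_Rintegral _ (integrable_kernel x intf)) _ => //.
have intfn : mu.-integrable setT (EFin \o (fun y => `|f y|)) by exact: integrable_norm.
rewrite /norm1 -RintegralZl//; apply: le_Rintegral => //.
- exact: (integrable_norm (integrable_kernel x intf)).
- exact: (integrableZl _ _ intfn).
- by move=> y _; rewrite normrM ler_wpM2r.
Qed.

Lemma integrable_kernel_op f : mu.-integrable setT (EFin \o f) ->
  mu.-integrable setT (EFin \o kernel_op q f).
Proof.
move=> intf; apply: (bounded_integrable (measurable_kernel_op intf)) => x.
exact: kernel_op_bound.
Qed.

Lemma kernel_opD f g x : mu.-integrable setT (EFin \o f) ->
  mu.-integrable setT (EFin \o g) ->
  kernel_op q (fun y => f y + g y) x = kernel_op q f x + kernel_op q g x.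
Proof.
move=> intf intg; rewrite /kernel_op -RintegralD//; last 2 first.
  exact: integrable_kernel.
  exact: integrable_kernel.
by apply: eq_Rintegral => y _; rewrite mulrDr.
Qed.

Lemma kernel_opZ f a x : mu.-integrable setT (EFin \o f) ->
  kernel_op q (fun y => a * f y) x = a * kernel_op q f x.
Proof.
move=> intf; rewrite /kernel_op -RintegralZl//; last exact: integrable_kernel.
by apply: eq_Rintegral => y _; rewrite mulrCA.
Qed.

(** The transposed kernel represents the adjoint. With [g = 1] the same identity expresses the
    integral of [kernel_op q f] through the column integrals of [q]. *)
Lemma kernel_op_swap f g : mu.-integrable setT (EFin \o f) ->
  mu.-integrable setT (EFin \o g) ->
  \int[mu]_x (g x * kernel_op q f x) =
  \int[mu]_y (f y * kernel_op (fun y x => q x y) g y).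
Proof.
move=> intf intg; have int2 := integrable_kernel2 intf intg.
have int2F := Fubini int2.
have EL x : (\int[mu]_y (g x * (q x y * f y))%:E)%E = (g x * kernel_op q f x)%:E.
  have iq := integrable_kernel x intf.
  rewrite -RintegralZl// /Rintegral fineK//.
  exact: (integrable_fin_num measurableT (integrableRZl (g x) iq)).
have ER y : (\int[mu]_x (g x * (q x y * f y))%:E)%E =
    (f y * kernel_op (fun y x => q x y) g y)%:E.
  have iq : mu.-integrable setT (EFin \o (fun x => q x y * g x)).
    apply: (@integrable_mul_bounded K) => //.
    exact: (measurableT_comp mq (pair2_measurable y)).
  rewrite -RintegralZl// /Rintegral fineK//; last first.
    exact: (integrable_fin_num measurableT (integrableRZl (f y) iq)).
  by apply: eq_integral => x _; congr EFin; ring.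
rewrite /Rintegral; congr fine.
under eq_integral do rewrite -EL; rewrite int2F.
by apply: eq_integral => y _; rewrite -ER.
Qed.

End bounded_kernel.
End kernel_operator.

(** * Integration on [0,1] *)

Section leb01.
Context {R : realType}.
Local Notation mu := (leb01 R).
Local Notation I := (`[0%R, 1%R]%classic : set R).

Lemma leb01E (A : set R) : mu A = lebesgue_measure (A `&` I).
Proof. by []. Qed.

Lemma leb01_setT : mu setT = 1%E.
Proof. by rewrite leb01E setTI lebesgue_measure_itv/= lte01 oppr0 adde0. Qed.

Lemma leb01_ae (P : R -> Prop) : (forall x, I x -> P x) -> {ae mu, forall x, P x}.
Proof.
move=> H; exists (~` I); split.
- by apply: measurableC; exact: measurable_itv.
- rewrite leb01E setICl. exact: measure0.
- by move=> x /= nP Ix; apply: nP; exact: H.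
Qed.

Import HBNNSimple.

(** Even for a non-measurable nonnegative function the integral is the supremum over the simple
    functions below it. Cutting such a simple function off outside [0,1] keeps its integral against
    [leb01] and puts it below [g]. *)
Let le_nnintegral01 (f g : R -> \bar R) : (forall x, 0 <= f x)%E ->
  (forall x, 0 <= g x)%E -> (forall x, I x -> f x = g x) ->
  (\int[mu]_x f x <= \int[mu]_x g x)%E.
Proof.
move=> f0 g0 fg; rewrite ge0_integralTE// [leRHS]ge0_integralTE//.
apply: ge_ereal_sup => _ [h /= hf <-].
pose h' := proj_nnsfun h (measurable_itv `[0%R, 1%R]).
have -> : sintegral mu h = sintegral mu h'.
  rewrite -!integralT_nnsfun; apply: ge0_ae_eq_integral => //.
  - exact/measurable_EFinP.
  - exact/measurable_EFinP.
  - by move=> x _; rewrite lee_fin fun_ge0.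
  - by move=> x _; rewrite lee_fin fun_ge0.
  - apply: leb01_ae => x Ix _; by rewrite /h' /= mindicE mem_set// mulr1.
apply: ereal_sup_ubound; exists h' => // x.
rewrite /h' /= mindicE; case: (boolP (x \in I)) => [|_].
  by rewrite inE mulr1 => Ix; rewrite -fg.
by rewrite mulr0.
Qed.

(* No measurability is assumed: T0 is arbitrary outside [0,1], hence so are the
   integrands of L0 and calG. *)
Lemma eq_integral01 (f g : R -> \bar R) : (forall x, I x -> f x = g x) ->
  (\int[mu]_x f x = \int[mu]_x g x)%E.
Proof.
move=> fg; rewrite integralE [RHS]integralE.
by congr (_ - _)%E; apply/eqP; rewrite eq_le; apply/andP; split;
  apply: le_nnintegral01 => // x Ix; rewrite ?funeposE ?funenegE fg.
Qed.

Lemma eq_Rintegral01 (f g : R -> R) : (forall x, I x -> f x = g x) ->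
  \int[mu]_x f x = \int[mu]_x g x.
Proof. by move=> fg; congr fine; apply: eq_integral01 => x /fg ->. Qed.

Lemma eq_norm2 (f g : R -> R) : (forall x, I x -> f x = g x) -> norm2 f = norm2 g.
Proof.
move=> fg; rewrite /norm2; congr fine; rewrite unlock; congr (_ `^ _)%E.
by apply: eq_integral01 => x /fg /= ->.
Qed.

Lemma bounded_integrable01 (f : R -> R) (M : R) :
  measurable_fun setT f -> (forall x, `|f x| <= M) -> mu.-integrable setT (EFin \o f).
Proof. by move=> mf fM; apply: (@bounded_integrable _ (measurableTypeR R) R (leb01 R) M) fM. Qed.
End leb01.

Lemma lipschitz_bound_continuous (R : realType) (f : R -> R) (K : R) :
  (forall x y, `|f x - f y| <= K * `|x - y|) -> continuous f.
Proof.
move=> fK x; apply/(@cvgrPdist_le _ R^o) => e e0.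
have K1 : 0 < `|K| + 1 by rewrite ltr_wpDl.
near=> y.
apply: (le_trans (fK x y)).
have : `|x - y| <= e / (`|K| + 1).
  near: y; apply: cvgr_dist_le; first exact: cvg_id.
  by rewrite divr_gt0.
rewrite ler_pdivlMr// => xy.
apply: le_trans xy; rewrite mulrC ler_wpM2l//.
by rewrite (le_trans (ler_norm _))// lerDl.
Unshelve. all: by end_near. Qed.

(** * The fundamental theorem of calculus for Lipschitz functions *)

Lemma lebesgue_stieltjes_itvoc (R : realType) (f : cumulative R R) (x y : R) :
  x <= y -> lebesgue_stieltjes_measure f `]x, y]%classic = (f y - f x)%:E.
Proof.
move=> xy; rewrite /lebesgue_stieltjes_measure /measure_extension/=.
rewrite measurable_mu_extE/= ?wlength_itv_bnd//.
exact: is_ocitv.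
Qed.

Section monotone_lipschitz.
Context {R : realType}.
Local Notation mu := (@lebesgue_measure R).
Context (h : R -> R).
Context (h_nd : {homo h : x y / x <= y}).
Context (idh_nd : {homo (fun x => x - h x) : x y / x <= y}).

(** The two monotonicity hypotheses together say that all difference quotients of [h] lie in
    [0,1]. *)
Let h_lip x y : `|h x - h y| <= 1 * `|x - y|.
Proof.
rewrite mul1r; wlog xy : x y / x <= y => [H|].
  by case/orP: (le_total x y) => /H //; rewrite distrC [leRHS]distrC.
have := h_nd xy; have := idh_nd xy => /= ? ?.
rewrite distrC [leRHS]distrC !ger0_norm ?subr_ge0//; lra.
Qed.

Let idh_lip x y : `|(x - h x) - (y - h y)| <= 2 * `|x - y|.
Proof.
have -> : (x - h x) - (y - h y) = (x - y) - (h x - h y) by ring.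
apply: (le_trans (ler_normB _ _)); have := h_lip x y; lra.
Qed.

(* The Stieltjes measures of h and id - h add up to Lebesgue measure, so the former
   is absolutely continuous. *)
Lemma monotone_density (a b : R) : a < b -> exists phi : R -> R,
  [/\ mu.-integrable setT (EFin \o phi),
      \int[mu]_(x in `[a, b]) phi x = h b - h a &
      {ae mu, forall x, x \in `]a, b[ -> derivable h x 1 /\ derive1 h x = phi x}].
Proof.
move=> ab.
pose hc : cumulative R R := HB.pack_for (cumulative R R) h
  (isCumulative.Build R _ R h h_nd (right_continuousW (lipschitz_bound_continuous h_lip))).
pose kc : cumulative R R := HB.pack_for (cumulative R R) (fun x => x - h x)
  (isCumulative.Build R _ R (fun x => x - h x) idh_nd
     (right_continuousW (lipschitz_bound_continuous idh_lip))).
pose nu1 : {measure set (measurableTypeR R) -> \bar R} := lebesgue_stieltjes_measure hc.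
pose nu2 : {measure set (measurableTypeR R) -> \bar R} := lebesgue_stieltjes_measure kc.
have nu1E x y : x <= y -> nu1 `]x, y]%classic = (h y - h x)%:E.
  exact: lebesgue_stieltjes_itvoc.
have nu2E x y : x <= y -> nu2 `]x, y]%classic = (y - h y - (x - h x))%:E.
  exact: lebesgue_stieltjes_itvoc.
have muE A : measurable A -> mu A = (nu1 A + nu2 A)%E.
  move=> mA; rewrite -measure_addE.
  apply: (@lebesgue_measure_unique R (measure_add nu1 nu2)) => // X /ocitvP[->|[[x y] /= xy ->]].
    by rewrite !measure0.
  rewrite [RHS]measure_addE nu1E ?nu2E ?ltW// lebesgue_measure_itv/= lte_fin xy -!EFinD.
  by congr EFin; ring.
have nu1ab : (nu1 `]a, b]%classic < +oo)%E by rewrite nu1E ?ltry// ltW.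
(* Restricting to []a, b]] makes the measure finite, so that its density is integrable over the
   whole line. *)
pose nu : {finite_measure set (measurableTypeR R) -> \bar R} :=
  @mfrestr _ (measurableTypeR R) _ _ nu1 (measurable_itv `]a, b]) nu1ab.
have numu : nu `<< mu.
  apply/null_content_dominatesP => A mA muA0.
  apply/eqP; rewrite eq_le measure_ge0 andbT.
  have nu1A : (nu1 A <= 0)%E.
    have <- : (nu1 A + nu2 A = 0)%E by rewrite -(muE A mA); exact: muA0.
    by rewrite leeDl// measure_ge0.
  apply: le_trans nu1A.
  by apply: le_measure; rewrite ?inE//; exact: measurableI.
have [f [f0 ffin fint fE]] := radon_nikodym_sigma_finite numu.
exists (fine \o f).
have EfE : EFin \o (fine \o f) = f by apply/funext => x /=; rewrite fineK.
have intE A : measurable A -> (\int[mu]_(x in A) (fine \o f) x)%R = fine (nu A).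
  move=> mA; rewrite /Rintegral fE//; congr fine.
  by apply: eq_integral => x _; rewrite -[LHS]/((EFin \o (fine \o f)) x) EfE.
(* Between [a] and [b] the primitive of the density from -oo is thus [h - h a], and differentiating
   it almost everywhere gives the derivative of [h]. *)
have nuE x : a <= x -> x <= b -> nu `]-oo, x]%classic = (h x - h a)%:E.
  move=> ax xb; rewrite -nu1E//; congr (nu1 _).
  apply/seteqP; split => y /=; rewrite !in_itv/=; [move=> [yx /andP[-> _]]//|].
  by move=> /andP[-> yx]; rewrite yx (le_trans yx).
split.
- by rewrite EfE.
- rewrite -Rintegral_itv_obnd_cbnd; last first.
    by apply: integrableS (subsetT _) _ => //; rewrite EfE.
  rewrite intE// /nu/= /mfrestr/= /mrestr setIid -/nu1 nu1E// ltW//.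
- have intf y : mu.-integrable `]-oo, y] (EFin \o (fine \o f)).
    by apply: integrableS (subsetT _) _ => //; rewrite EfE.
  have lf : locally_integrable setT (fine \o f).
    rewrite (_ : fine \o f = (fine \o f) \_ setT); last by rewrite patch_setT.
    by apply: integrable_locally_restrict => //; rewrite EfE.
  have := FTC1Ny intf lf => /=; apply: filterS; first exact: (ae_filter_ringOfSetsType mu).
  move=> x [dF F'] xab.
  have [ax xb] : a < x /\ x < b by move: xab; rewrite in_itv => /andP.
  have nearE : \forall y \near x, \int[mu]_(t in `]-oo, y]) (fine \o f) t + h a = h y.
    near=> y.
    have ay : a < y by near: y; exact: lt_nbhsr.
    have yb : y < b by near: y; exact: lt_nbhsl.
    by rewrite intE// nuE/= ?subrK// ltW.
  have dFa : is_derive x 1 (fun y => \int[mu]_(t in `]-oo, y]) (fine \o f) t + h a) (fine (f x)).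
    rewrite -[fine (f x)]addr0; apply: is_deriveD.
    by rewrite -[fine (f x)]F' derive1E; exact: derivableP.
  have dh := near_eq_is_derive nearE dFa.
  by split; [exact: ex_derive|rewrite derive1E derive_val].
Unshelve. all: by end_near. Qed.
End monotone_lipschitz.

(** * The almost everywhere derivative: measurability, Lipschitz functions, symmetries *)

Section ae_derivative.
Context {R : realType}.
Local Notation mu := (@lebesgue_measure R).

Let quot (f : R -> R) (h x : R) := h^-1 * (f (h + x) - f x).

Let derivableE (f : R -> R) x :
  derivable f x 1 = (cvg (quot f h x @[h --> 0^'])).
Proof.
rewrite /derivable; set g := (X in cvg (X @ _)).
have -> // : g = quot f ^~ x.
by apply/funext => h; rewrite /g /quot /= [h *: 1]mulr1.
Qed.

Let derive1_quot (f : R -> R) x :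
  derive1 f x = lim (quot f h x @[h --> 0^']).
Proof. by []. Qed.

(* An arbitrary intersection of closed sets, hence closed for continuous f: this
   gives a Borel set of differentiability points by Cauchy's criterion. *)
Let osc (f : R -> R) (k n : nat) : set R :=
  \bigcap_(p in [set p : R * R | 0 < `|p.1| < n.+1%:R^-1 /\ 0 < `|p.2| < n.+1%:R^-1])
    [set x | `|quot f p.1 x - quot f p.2 x| <= k.+1%:R^-1].

Let derivable_osc (f : R -> R) :
  [set x | derivable f x 1] = \bigcap_k \bigcup_n osc f k n.
Proof.
apply/seteqP; split => x /=; rewrite derivableE.
- move=> /cvg_ex[/= L] /(@cvgrPdist_le _ R^o) fL k _.
  have /fL : 0 < k.+1%:R^-1 / 2 :> R by rewrite divr_gt0// invr_gt0.
  move=> [e /= e0 H].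
  have [n ne] : exists n : nat, n.+1%:R^-1 < e by have /ltr_add_invr[n] := e0; rewrite add0r; exists n.
  exists n => // -[h h'] /= [/andP[h0 hn] /andP[h'0 h'n]].
  have /= E1 := H h; have /= E2 := H h'.
  move: E1; rewrite sub0r normrN => /(_ (lt_trans hn ne)).
  rewrite -normr_gt0 => /(_ h0) E1.
  move: E2; rewrite sub0r normrN => /(_ (lt_trans h'n ne)).
  rewrite -normr_gt0 => /(_ h'0) E2.
  rewrite (le_trans (ler_distD L _ _))// distrC.
  by rewrite [leRHS](splitr) lerD.
- move=> H; apply/cauchy_cvgP/cauchyP => e e0.
  have /ltr_add_invr[k] := e0; rewrite add0r => ke.
  have [n _ nH] := H k I.
  (* The Cauchy criterion asks for a centre: the quotient at increment 1/(n+2), which is admissible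
     in [osc f k n]. *)
  exists (quot f (n.+2%:R^-1) x) => /=.
  have n0 : 0 < n.+1%:R^-1 :> R by rewrite invr_gt0.
  exists n.+1%:R^-1 => //= h /=; rewrite sub0r normrN -normr_gt0 => hn h0.
  apply: le_lt_trans ke; apply: (nH (n.+2%:R^-1, h)) => /=; split; last by rewrite h0.
  by rewrite normfV ger0_norm ?ler0n// invr_gt0 ltr0Sn ltf_pV2 ?posrE// ltr_nat ltnSn.
Qed.

(** The derivative is the limit of the quotients at increments 1/(n+1). Multiplying them by the
    indicator of the set of differentiability, Borel by [derivable_osc], makes them converge to the
    default value 0 elsewhere. *)
Lemma measurable_ae_derivative (f : R -> R) : continuous f ->
  measurable_fun setT (ae_derivative f).
Proof.
move=> cf.
have cq h : continuous (quot f h).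
  move=> x; apply: (@cvgM _ R^o); first exact: cvg_cst.
  apply: (@cvgB _ R^o); last exact: cf.
  apply: (@continuous_comp _ _ _ (fun x => h + x) f); last exact: cf.
  by apply: (@cvgD _ R^o); [exact: cvg_cst|exact: cvg_id].
have mD : measurable [set x | derivable f x 1].
  rewrite derivable_osc; apply: bigcapT_measurable => k.
  apply: bigcupT_measurable => n; apply: closed_measurable.
  apply: closed_bigI => p _.
  apply: (@preimage_closed _ _ (fun x => `|quot f p.1 x - quot f p.2 x|) [set y | y <= k.+1%:R^-1]).
    move=> z _; apply: (@continuous_comp _ _ _ (fun x => quot f p.1 x - quot f p.2 x) Num.norm).
      by apply: (@cvgB _ R^o); exact: cq.
    exact: (@norm_continuous _ R^o).
  exact: closed_le.
have h0 : n.+1%:R^-1 @[n --> \oo] --> (0 : R)^'.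
  move=> A A0; have [N _ HN] := @cvg_harmonic R _ A0.
  exists N => // n /HN; apply.
  by have : n.+1%:R^-1 != 0 :> R by rewrite invr_eq0 pnatr_eq0.
apply: (@measurable_fun_cvg _ _ _ _ (fun n x => quot f n.+1%:R^-1 x * \1_[set x | derivable f x 1] x)) => //.
- move=> n; apply: measurable_funM; last exact: measurable_indic.
  exact: continuous_measurable_fun.
- move=> x _; rewrite /ae_derivative indicE; case: asboolP => dx.
    under eq_fun do rewrite (mem_set (A := [set x | derivable f x 1]) (u := x) dx) mulr1.
    rewrite derive1_quot; rewrite derivableE in dx.
    exact: (cvg_comp _ _ h0 dx).
  under eq_fun do rewrite (memNset (A := [set x | derivable f x 1]) (u := x) dx) mulr0.
  exact: cvg_cst.
Qed.

Lemma lipschitz_FTC (f : R -> R) (K a b : R) :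
  (forall x y, `|f x - f y| <= K * `|x - y|) -> a <= b ->
  \int[mu]_(x in `[a, b]) ae_derivative f x = f b - f a.
Proof.
move=> fK; rewrite le_eqVlt => /predU1P[<-|ab].
  by rewrite set_itv1 Rintegral_set1 subrr.
have cf := lipschitz_bound_continuous fK.
pose C := `|K| + 1.
have C0 : 0 < C by rewrite ltr_wpDl.
have fC x y : x <= y -> `|f x - f y| <= C * y - C * x.
  move=> xy; rewrite -mulrBr; apply: (le_trans (fK x y)).
  rewrite distrC ger0_norm ?subr_ge0// ler_wpM2r ?subr_ge0//.
  by rewrite (le_trans (ler_norm _))// lerDl.
(* The difference quotients of [f x + C * x] lie in [0, 2C]; dividing by 2C puts those of [h] in
   [0,1], as [monotone_density] requires. *)
pose h x := (2 * C)^-1 * (f x + C * x).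
have fE x : f x = 2 * C * h x - C * x.
  by rewrite /h; field; rewrite gt_eqF.
have h_nd : {homo h : x y / x <= y}.
  move=> x y /fC; rewrite ler_norml => /andP[? ?].
  by apply: ler_wpM2l; [rewrite invr_ge0 mulr_ge0// ltW|lra].
have idh_nd : {homo (fun x => x - h x) : x y / x <= y}.
  move=> x y /fC; rewrite ler_norml => /andP[? ?].
  have idhE z : z - h z = (2 * C)^-1 * (C * z - f z).
    by rewrite /h; field; rewrite gt_eqF.
  by rewrite !idhE; apply: ler_wpM2l; [rewrite invr_ge0 mulr_ge0// ltW|lra].
have [phi [iphi phiE aephi]] := monotone_density h_nd idh_nd ab.
have sphi : mu.-integrable `[a, b] (EFin \o phi) by exact: integrableS (subsetT _) iphi.
have ic : mu.-integrable `[a, b] (EFin \o (fun=> C)).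
  apply: measurable_bounded_integrable => //.
    by rewrite /= lebesgue_measure_itv/= lte_fin ab -EFinB ltry.
  by exists C; split; [exact: num_real|move=> M CM x _ /=; rewrite ltW// gtr0_norm].
have ipsi : mu.-integrable `[a, b] (EFin \o (fun x => 2 * C * phi x)).
  exact: (integrableZl _ _ sphi).
have mphi : measurable_fun setT phi by have /integrableP[/measurable_EFinP] := iphi.
transitivity (\int[mu]_(x in `[a, b]) (2 * C * phi x - C)).
  have mf' := measurable_ae_derivative cf.
  have mpsi : measurable_fun setT (fun x => 2 * C * phi x - C).
    by apply: measurable_funB => //; apply: measurable_funM.
  (* The density is identified with the derivative only on the open interval, so the end points are
     dropped first. *)
  rewrite /Rintegral (@integral_itv_bndoo R a b _ true false); last first.
    by apply: measurable_funTS; exact/measurable_EFinP.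
  rewrite [in RHS](@integral_itv_bndoo R a b _ true false); last first.
    by apply: measurable_funTS; exact/measurable_EFinP.
  congr fine.
  apply: ae_eq_integral => //=.
  - by apply: measurable_funTS; exact/measurable_EFinP.
  - by apply: measurable_funTS; exact/measurable_EFinP.
  - move: aephi; apply: filterS; first exact: (ae_filter_ringOfSetsType mu).
    move=> x H /H[dh h'x].
    have df : is_derive x 1 f (2 * C * phi x - C).
      have -> : f = (fun x => 2 * C * h x - C * x) by apply/funext.
      have dhx : is_derive x 1 h (phi x) by rewrite -h'x derive1E; exact: derivableP.
      have d1 : is_derive x 1 ((2 * C) \*: (h : R -> R^o)) ((2 * C) *: (phi x : R^o)).
        exact: is_deriveZ.
      have d2 : is_derive x 1 (C \*: (id : R -> R^o)) (C *: (1 : R^o)) by exact: is_deriveZ.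
      by have := @is_deriveB _ _ _ _ _ _ _ _ _ d1 d2; rewrite [_ *: 1]mulr1.
    by rewrite /ae_derivative asboolT ?derive1E ?derive_val//; exact: ex_derive.
rewrite RintegralB//= RintegralZl// phiE Rintegral_cst//= lebesgue_measure_itv/= lte_fin ab/=.
rewrite !fE; ring.
Qed.

Lemma ae_derivative_bounded (f : R -> R) (K x : R) :
  (forall y z, `|f y - f z| <= K * `|y - z|) -> `|ae_derivative f x| <= K.
Proof.
move=> fK; rewrite /ae_derivative; case: asboolP => dx; last first.
  by rewrite normr0; have := fK 1 0; rewrite subr0 normr1 mulr1; exact: le_trans.
rewrite derivableE in dx; rewrite derive1_quot.
have qK h : h != 0 -> `|quot f h x| <= K.
  move=> h0; rewrite /quot normrM normfV mulrC ler_pdivrMr ?normr_gt0//.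
  by apply: le_trans (fK _ _) _; rewrite addrK.
by rewrite ler_norml; apply/andP; split; [apply: limr_ge|apply: limr_le] => //;
  near=> h; have := qK h; rewrite ler_norml => /(_ _)/andP[]//; near: h; exact: nbhs_dnbhs_neq.
Unshelve. all: by end_near. Qed.

Lemma ae_derivative_supp (f : R -> R) : continuous f -> 
  (forall x, ~ (-1 <= x <= 1) -> f x = 0) ->
  forall x, ~ (-1 <= x <= 1) -> ae_derivative f x = 0.
Proof.
move=> cf f0 x x1.
have d0 : is_derive x 1 (cst (0 : R)) (0 : R) by apply: is_derive_cst.
have H : is_derive x 1 f 0.
  apply: near_eq_is_derive d0.
  have oD : open (~` [set y : R | -1 <= y <= 1]).
    have -> : [set y : R | -1 <= y <= 1] = `[-1, 1]%classic.
      by apply/seteqP; split => y; rewrite /= in_itv.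
    exact/closed_openC/itv_closed.
  near=> y; rewrite f0//; near: y; exact: (open_nbhs_nbhs (conj oD x1)).
by rewrite /ae_derivative asboolT ?derive1E ?derive_val//; exact: ex_derive.
Unshelve. all: by end_near. Qed.

Lemma ae_derivative_shift (f : R -> R) (s x : R) :
  ae_derivative (fun y => f (y + s)) x = ae_derivative f (x + s).
Proof.
have E : quot (fun y => f (y + s)) ^~ x = quot f ^~ (x + s).
  by apply/funext => h; rewrite /quot addrA.
by rewrite /ae_derivative !derivableE !derive1_quot E.
Qed.

(** Derivability is transferred in both directions, since the default value 0 must be taken at
    corresponding points on both sides. *)
Lemma ae_derivative_refl (f : R -> R) (s x : R) :
  ae_derivative (fun y => f (s - y)) x = - ae_derivative f (s - x).
Proof.
have E : quot (fun y => f (s - y)) ^~ x = (fun h => - quot f h (s - x)) \o -%R.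
  apply/funext => h; rewrite /quot /= invrN mulNr opprK; congr (_ * (f _ - _)); ring.
have N0 : -%R h @[h --> (0 : R)^'] --> (0 : R)^'.
  rewrite -[in X in _ --> X]oppr0; apply: continuous_injective_withinNx.
    by apply: (@cvgN _ R^o); exact: cvg_id.
  by move=> y /oppr_inj.
rewrite /ae_derivative !derivableE !derive1_quot E; case: asboolP => H1; case: asboolP => H2.
- apply/cvg_lim => //; apply: (cvg_comp _ _ N0); exact: (@cvgN _ R^o).
- exfalso; apply: H2; have := cvgN (cvg_comp _ _ N0 H1).
  rewrite (_ : - _ = quot f ^~ (s - x)); last first.
    by apply/funext => h; rewrite /= fctE /= !opprK.
  by move=> cvgN'; apply/cvg_ex; eexists; exact: cvgN'.
- exfalso; apply: H1; apply/cvg_ex; exists (- lim (quot f h (s - x) @[h --> 0^'])).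
  apply: (cvg_comp _ _ N0); exact: (@cvgN _ R^o).
- by rewrite oppr0.
Qed.

End ae_derivative.

(** * The folded kernels *)

Section folding.
Context {R : realType}.
Local Notation mu := (@lebesgue_measure R).
Local Notation I := (`[0%R, 1%R]%classic : set R).
Implicit Types (g : R -> R) (x t : R).

Lemma Rintegral_leb01 (f : R -> R) : \int[leb01 R]_x f x = \int[mu]_(x in I) f x.
Proof.
rewrite /Rintegral; congr fine.
transitivity (\int[leb01 R]_(x in I) (f x)%:E)%E.
  by rewrite [RHS]integral_mkcond; apply: eq_integral01 => x Ix; rewrite patchE mem_set.
by apply: eq_measure_integral => A mA AI; have := leb01E A; rewrite (setIidl AI).
Qed.

(* The three terms i = -2, 0, 2 of the sum defining P_pi: the only ones which do not
   vanish when x and t are in [0,1] and g is supported on [-1,1]. *)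
Definition fold6 g x t : R :=
  (g (x + (-2 - t)) + g ((-2 - t) - x)) + (g (x + (0 - t)) + g ((0 - t) - x)) +
  (g (x + (2 - t)) + g ((2 - t) - x)).

Lemma P_piE g x t : (forall x, ~ (-1 <= x <= 1) -> g x = 0) ->
  0 <= x <= 1 -> 0 <= t <= 1 -> P_pi (translate (- t) g) x = fold6 g x t.
Proof.
move=> g0 /andP[x0 x1] /andP[t0 t1].
have g_lt z : z < -1 -> g z = 0 by move=> z1; apply: g0 => /andP[]; lra.
have g_gt z : 1 < z -> g z = 0 by move=> z1; apply: g0 => /andP[]; lra.
rewrite /P_pi /translate.
rewrite -(@fsbig_widen _ _ _ _ [set` [:: (-2)%R; 0; 2%:Z]]); last 2 first.
- by move=> i /=; rewrite !inE => /or3P[] /eqP ->.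
- move=> i [/= i2 /negP]; rewrite !inE !negb_or => /and3P[iN2 i0 iP2].
  (* For such [i] the points [i + x - t] and [i - x - t] are at least 2 or at most -3, hence outside
     the support. *)
  have : (i <= -4) || (4 <= i).
    move: i2 => /dvdzP[k ik]; move: iN2 i0 iP2; rewrite ik; lia.
  case/orP; rewrite -(ler_int R) => i4 /=.
    have {}i4 : i%:~R <= - 4 :> R by move: i4; rewrite mulrNz.
    by rewrite !g_lt ?addr0//; lra.
  by rewrite !g_gt ?addr0//; lra.
rewrite -fsbig_seq//= !big_cons big_nil addr0 /fold6 -[RHS]addrA.
congr (_ + _ + (_ + _ + (_ + _))); congr g; ring.
Qed.

(** As x runs over [0,1], [x + s] and [s - x] together cover [[s - 1, s + 1]]. For s = -2 - t, -t, 2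
    - t these intervals are adjacent and tile [[-3 - t, 3 - t]], so the integrals telescope. *)
Lemma fold6_FTC (f : R -> R) (K t : R) :
  (forall x y, `|f x - f y| <= K * `|x - y|) ->
  \int[leb01 R]_x fold6 (ae_derivative f) x t = f (3 - t) - f (-3 - t).
Proof.
move=> fK.
have md : measurable_fun setT (ae_derivative f).
  by apply: measurable_ae_derivative; exact: lipschitz_bound_continuous fK.
have mS s : measurable_fun setT (fun x => ae_derivative f (x + s)).
  by apply: (measurableT_comp md); apply: measurable_funD.
have mN s : measurable_fun setT (fun x => ae_derivative f (s - x)).
  by apply: (measurableT_comp md); apply: measurable_funB.
have iS s : (leb01 R).-integrable setT (EFin \o (fun x => ae_derivative f (x + s))).
  apply: (@bounded_integrable01 _ _ K) => // x.
  exact: (ae_derivative_bounded _ fK).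
have iN s : (leb01 R).-integrable setT (EFin \o (fun x => ae_derivative f (s - x))).
  apply: (@bounded_integrable01 _ _ K) => // x.
  exact: (ae_derivative_bounded _ fK).
have ES s : \int[leb01 R]_x ae_derivative f (x + s) = f (1 + s) - f (0 + s).
  have lipS x y : `|f (x + s) - f (y + s)| <= K * `|x - y|.
    by have -> : x - y = (x + s) - (y + s) by ring.
  have <- := lipschitz_FTC lipS ler01.
  rewrite Rintegral_leb01.
  by apply: eq_Rintegral => x _; rewrite ae_derivative_shift.
have EN s : \int[leb01 R]_x ae_derivative f (s - x) = f (s - 0) - f (s - 1).
  have lipN x y : `|f (s - x) - f (s - y)| <= K * `|x - y|.
    by have -> : `|x - y| = `|(s - x) - (s - y)| by rewrite distrC; congr (`|_|); ring.
  rewrite -[LHS]opprK -[RHS]opprB; congr (- _).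
  have <- := lipschitz_FTC lipN ler01.
  rewrite Rintegral_leb01 -mulN1r -RintegralZl//.
    by apply: eq_Rintegral => x _; rewrite ae_derivative_refl mulN1r.
  apply: measurable_bounded_integrable => //.
  - exact: lebesgue_measure01_lty.
  - by apply: measurable_funTS; apply: mN.
  - exists K; split; [exact: num_real|move=> N KN x _ /=].
    by rewrite (le_trans (ae_derivative_bounded _ fK))// ltW.
have iD (a b : R -> R) : (leb01 R).-integrable setT (EFin \o a) ->
  (leb01 R).-integrable setT (EFin \o b) -> (leb01 R).-integrable setT (EFin \o (fun x => a x + b x)).
  by move=> ia ib; have := integrableD measurableT ia ib.
have iP s := iD _ _ (iS s) (iN s).
have EP s : \int[leb01 R]_x (ae_derivative f (x + s) + ae_derivative f (s - x)) =
    (f (1 + s) - f (0 + s)) + (f (s - 0) - f (s - 1)).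
  by rewrite (RintegralD measurableT (iS s) (iN s)) ES EN.
rewrite /fold6 (RintegralD measurableT (iD _ _ (iP (-2 - t)) (iP (0 - t))) (iP (2 - t))).
rewrite (RintegralD measurableT (iP (-2 - t)) (iP (0 - t))) !EP.
have -> : 1 + (-2 - t) = (0 - t) - 1 by ring.
have -> : 1 + (0 - t) = (2 - t) - 1 by ring.
have -> : (-2 - t) - 1 = -3 - t by ring.
have -> : 1 + (2 - t) = 3 - t by ring.
by rewrite !subr0 !add0r; ring.
Qed.
End folding.

(** * Mass, bounds and regularity of the folded kernels *)

Section density.
Context {R : realType}.
Local Notation mu := (@lebesgue_measure R).
Local Notation I := (`[0%R, 1%R]%classic : set R).
Implicit Types (g : R -> R).

Lemma lipschitzP (f : R -> R) : lipschitz f ->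
  exists K, forall x y, `|f x - f y| <= K * `|x - y|.
Proof.
move=> [M [_ fM]]; exists (M + 1) => x y.
by have := fM (M + 1); rewrite ltrDl ltr01 => /(_ erefl (x, y)); apply.
Qed.

(** Compare with the point 2, where [f] vanishes and which is within 3 of every point of [-1,1]. *)
Lemma lipschitz_supp_bounded (f : R -> R) (K : R) :
  (forall x y, `|f x - f y| <= K * `|x - y|) ->
  (forall x, ~ (-1 <= x <= 1) -> f x = 0) -> forall x, `|f x| <= 3 * K.
Proof.
move=> fK f0 x.
have K0 : 0 <= K by have := fK 1 0; rewrite subr0 normr1 mulr1; exact: le_trans.
have [x1|x1] := pselect (-1 <= x <= 1); last by rewrite f0// normr0 mulr_ge0.
have := fK x 2; rewrite (f0 2) ?subr0; last by case/andP => _; lra.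
move/le_trans; apply; rewrite mulrC ler_wpM2r//.
move: x1 => /andP[? ?]; rewrite ler_norml; apply/andP; split; lra.
Qed.

Lemma measurable_fold6 g (t : R -> R) : measurable_fun setT g -> measurable_fun setT t ->
  measurable_fun setT (fun z : R * R => fold6 g z.1 (t z.2)).
Proof.
move=> mg mt.
have mt2 : measurable_fun setT (fun z : R * R => t z.2) by exact: measurableT_comp.
have mD (c : R) : measurable_fun setT (fun z : R * R => g (z.1 + (c - t z.2))).
  by apply: (measurableT_comp mg); apply: measurable_funD => //; apply: measurable_funB.
have mB (c : R) : measurable_fun setT (fun z : R * R => g ((c - t z.2) - z.1)).
  by apply: (measurableT_comp mg); apply: measurable_funB => //; apply: measurable_funB.
have mP (c : R) := measurable_funD (mD c) (mB c).
exact: (measurable_funD (measurable_funD (mP (-2)) (mP 0)) (mP 2)).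
Qed.

Lemma fold6_bound g (M : R) x t : (forall x, `|g x| <= M) -> `|fold6 g x t| <= 6 * M.
Proof.
move=> gM; rewrite /fold6.
have gMl z : - M <= g z by have := gM z; rewrite ler_norml => /andP[].
have gMr z : g z <= M by have := gM z; rewrite ler_norml => /andP[].
rewrite ler_norml.
have l1 := gMl (x + (-2 - t)); have r1 := gMr (x + (-2 - t)).
have l2 := gMl (-2 - t - x); have r2 := gMr (-2 - t - x).
have l3 := gMl (x + (0 - t)); have r3 := gMr (x + (0 - t)).
have l4 := gMl (0 - t - x); have r4 := gMr (0 - t - x).
have l5 := gMl (x + (2 - t)); have r5 := gMr (x + (2 - t)).
have l6 := gMl (2 - t - x); have r6 := gMr (2 - t - x).
by apply/andP; split; lra.
Qed.

Lemma fold6_lipschitz g (K : R) x x' t :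
  (forall x y, `|g x - g y| <= K * `|x - y|) ->
  `|fold6 g x t - fold6 g x' t| <= 6 * K * `|x - x'|.
Proof.
move=> gK.
have gD (c : R) : `|g (x + c) - g (x' + c)| <= K * `|x - x'|.
  by have -> : x - x' = (x + c) - (x' + c) by ring.
have gB (c : R) : `|g (c - x) - g (c - x')| <= K * `|x - x'|.
  by have -> : `|x - x'| = `|(c - x) - (c - x')| by rewrite distrC; congr (`|_|); ring.
have := gD (-2 - t); have := gD (0 - t); have := gD (2 - t).
have := gB (-2 - t); have := gB (0 - t); have := gB (2 - t).
rewrite /fold6 !ler_norml => /andP[? ?] /andP[? ?] /andP[? ?] /andP[? ?] /andP[? ?] /andP[? ?].
by rewrite -mulrA; apply/andP; split; lra.
Qed.

(** The primitive [F] of [rho] is Lipschitz as [rho] is bounded, and has derivative [rho] everywhere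
    as [rho] is continuous. So [fold6_FTC] applies to [F], and [[-3 - t, 3 - t]] contains the
    support of [rho]. *)
Lemma fold6_density (rho : R -> R) (K t : R) :
  (forall x y, `|rho x - rho y| <= K * `|x - y|) ->
  (forall x, 0 <= rho x) -> (\int[mu]_x (rho x)%:E = 1)%E ->
  (forall x, ~ (-1 <= x <= 1) -> rho x = 0) -> 0 <= t <= 1 ->
  \int[leb01 R]_x fold6 rho x t = 1.
Proof.
move=> rhoK rho0 rho1 rhos /andP[t0 t1].
have crho := lipschitz_bound_continuous rhoK.
have irho : mu.-integrable setT (EFin \o rho).
  apply/integrableP; split; first by apply/measurable_EFinP; exact: continuous_measurable_fun.
  under eq_integral do rewrite gee0_abs ?lee_fin//.
  by rewrite rho1 ltry.
pose F y := \int[mu]_(x in `]-oo, y]) rho x.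
have isub (A : set R) : measurable A -> mu.-integrable A (EFin \o rho).
  by move=> mA; apply: integrableS irho.
have dF (x : R) : is_derive x 1 F (rho x).
  have x1 : x < x + 1 by rewrite ltrDl.
  have [dFx F'x] := @continuous_FTC1 R rho -oo%O x (x + 1) x1
     (isub _ (measurable_itv _)) (ltNyr _) (crho x).
  by rewrite -F'x derive1E; exact: derivableP.
have F'E : ae_derivative F = rho.
  by apply/funext => x; rewrite /ae_derivative asboolT ?derive1E ?derive_val//; exact: ex_derive.
have FK x y : `|F x - F y| <= (3 * K) * `|x - y|.
  wlog xy : x y / x <= y => [H|].
    by case/orP: (le_total x y) => /H //; rewrite distrC (distrC x).
  have FE : F y - F x = \int[mu]_(z in `]x, y]) rho z.
    by rewrite /F Rintegral_itvB//; exact: isub.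
  rewrite distrC FE (le_trans (le_normr_Rintegral _ (isub _ _)))//.
  have fin : (mu `]x, y]%classic < +oo)%E.
    by rewrite lebesgue_measure_itv/=; case: ifP => _; rewrite ?ltry// -EFinB ltry.
  apply: (@le_trans _ _ (\int[mu]_(z in `]x, y]) (3 * K))).
    apply: le_Rintegral => //.
    - exact: (integrable_norm (isub _ _)).
    - apply: measurable_bounded_integrable => //.
      by exists `|3 * K|; split; [exact: num_real|move=> M CM z _ /=; rewrite ltW].
    - by move=> z _; rewrite lipschitz_supp_bounded.
  rewrite Rintegral_cst//= lebesgue_measure_itv/= lte_fin distrC ger0_norm ?subr_ge0//.
  move: xy; rewrite le_eqVlt => /predU1P[->|->]; last by [].
  by rewrite ltxx subrr mulr0.
rewrite -F'E (fold6_FTC t FK).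
have -> : F (-3 - t) = 0.
  transitivity (\int[mu]_(x in `]-oo, (-3 - t)%R]) (0 : R)); last first.
    by rewrite /Rintegral integral0.
  apply: eq_Rintegral => x; rewrite inE/= in_itv/= => xt; apply: rhos => /andP[]; lra.
rewrite subr0 /F Rintegral_mkcond /Rintegral.
transitivity (fine (\int[mu]_x (rho x)%:E)); last by rewrite rho1.
congr fine; apply: eq_integral => x _; rewrite patchE; case: ifPn => //.
rewrite notin_setE/= in_itv/= => /negP; rewrite -ltNge => xt.
by rewrite rhos// => /andP[]; lra.
Qed.

(* Cut off outside [0,1]^2, so as to be jointly measurable. *)
Definition ker01 (T0 g : R -> R) (x y : R) : R :=
  \1_I x * \1_I y * fold6 g x ((T0 \_ I) y).

Lemma ker01E (T0 g : R -> R) x y : (forall x, 0 <= x <= 1 -> 0 <= T0 x <= 1) ->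
  (forall x, ~ (-1 <= x <= 1) -> g x = 0) -> I x -> I y ->
  P_pi (translate (- T0 y) g) x = ker01 T0 g x y.
Proof.
move=> T001 g0 Ix Iy; rewrite /ker01 !indicE !mem_set// !mul1r patchE mem_set//.
move: Ix Iy; rewrite /= !in_itv/= => Ix Iy.
by rewrite P_piE//; exact: T001.
Qed.

Lemma ker01_bounded (T0 g : R -> R) (M : R) : measurable_fun I T0 ->
  measurable_fun setT g -> (forall x, `|g x| <= M) ->
  @bounded_kernel _ (measurableTypeR R) R (6 * M) (ker01 T0 g).
Proof.
move=> mT0 mg gM; split; last first.
  move=> x y; rewrite /ker01 !normrM !indicE !normr_nat -natrM -[leRHS]mul1r.
  apply: ler_pM => //; last exact: fold6_bound.
  by case: (_ \in _); case: (_ \in _).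
have mI : measurable_fun setT (\1_I : R -> R) by apply: measurable_indic; exact: measurable_itv.
have mT : measurable_fun setT (T0 \_ I).
  by apply/(measurable_restrictT _ _).1 => //; exact: measurable_itv.
apply: measurable_funM; last exact: measurable_fold6.
by apply: measurable_funM; apply: (measurableT_comp mI).
Qed.
End density.

(** * Markov kernels on [0,1] and the Neumann series *)

Section dominated_Rintegral.
Context d (T : measurableType d) (R : realType) (mu : {measure set T -> \bar R}).

Lemma cvg_Rintegral_dominated (f_ : nat -> T -> R) (f g : T -> R) :
  (forall n, measurable_fun setT (f_ n)) -> mu.-integrable setT (EFin \o g) ->
  (forall x, f_ n x @[n --> \oo] --> f x) -> (forall n x, `|f_ n x| <= g x) ->
  mu.-integrable setT (EFin \o f) /\ \int[mu]_x f_ n x @[n --> \oo] --> \int[mu]_x f x.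
Proof.
move=> mf_ intg f_f f_g.
have mf : measurable_fun setT f by apply: (measurable_fun_cvg mf_) => x _; exact: f_f.
have intfn n : mu.-integrable setT (EFin \o f_ n).
  apply: le_integrable intg => //; first exact/measurable_EFinP.
  by move=> x _ /=; rewrite lee_fin (le_trans (f_g n x))// ler_norm.
have [intf _ lim_int] : [/\ mu.-integrable setT (EFin \o f),
    [sequence \int[mu]_x `|(f_ n x)%:E - (f x)%:E|]_n @ \oo --> 0 &
    [sequence \int[mu]_x (f_ n x)%:E]_n @ \oo --> \int[mu]_x (f x)%:E]%E.
  apply: (@dominated_convergence _ _ _ mu setT measurableT
    (fun n => EFin \o f_ n) (EFin \o f) (EFin \o g)) => //.
  - by move=> n; exact/measurable_EFinP.
  - exact/measurable_EFinP.
  - by apply: aeW => x _; apply/cvg_EFin; [exact: nearW|exact: f_f].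
  - by apply: aeW => x n _; rewrite /= lee_fin.
split => //; apply: fine_cvg.
by rewrite /Rintegral fineK//; exact: (integrable_fin_num measurableT intf).
Qed.
End dominated_Rintegral.

Section markov_kernel01.
Context {R : realType}.
Local Notation mu := (leb01 R).
Local Notation I := (`[0%R, 1%R]%classic : set R).
Local Notation int1 f := (mu.-integrable setT (EFin \o f)).
Local Notation TR := (measurableTypeR R).

Lemma Rintegral_cst01 (c : R) : \int[mu]_x c = c.
Proof.
rewrite Rintegral_cst// -[RHS]mulr1; congr (_ * _).
exact: (congr1 fine (@leb01_setT R)).
Qed.

Lemma norm1_le01 (f : R -> R) (M : R) : int1 f -> (forall x, I x -> `|f x| <= M) ->
  norm1 mu f <= M.
Proof.
move=> intf fM.
have M0 : 0 <= M by apply: le_trans (fM 0 _); rewrite //= in_itv/= lexx ler01.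
have -> : norm1 mu f = \int[mu]_x `|(f \_ I) x|.
  by apply: eq_Rintegral01 => x Ix; rewrite patchE mem_set.
rewrite -[leRHS]Rintegral_cst01.
apply: le_Rintegral => //.
- apply: integrable_norm => //.
  have -> : EFin \o (f \_ I) = (EFin \o f) \_ I.
    by apply/funext => x; rewrite /= !patchE; case: ifP.
  rewrite -integrable_mkcond; last exact: measurable_itv.
  by apply: integrableS intf => //; exact: measurable_itv.
- by apply: (@bounded_integrable01 _ _ `|M|) => // x.
- by move=> x _; rewrite patchE; case: ifPn => [/set_mem/fM//|_]; rewrite normr0.
Qed.

Context (q : TR -> TR -> R) (K C : R) (bq : bounded_kernel K q).
Context (q_ge0 : forall x y, 0 <= q x y).
Context (q_mass : forall y, I y -> \int[mu]_x q x y = 1).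
Context (q_lip : forall x x' y, I x -> I x' -> `|q x y - q x' y| <= C * `|x - x'|).

Let A : (R -> R) -> R -> R := kernel_op mu q.
Let meanzero (f : R -> R) := int1 f /\ \int[mu]_x f x = 0.

Let K0 : 0 <= K. Proof. by case: bq => _ qK; exact: le_trans (normr_ge0 _) (qK 0 0). Qed.
Let C0 : 0 <= C.
Proof.
have := q_lip 0 (x := 1) (x' := 0); rewrite subr0 normr1 mulr1 => /(_ _ _) H.
by apply: le_trans (normr_ge0 _) (H _ _); rewrite //= in_itv/= ?lexx ?ler01.
Qed.

Lemma int1_kernel_op f : int1 f -> int1 (A f). Proof. exact: (integrable_kernel_op bq). Qed.

Lemma int1_iter n f : int1 f -> int1 (iter n A f).
Proof. by move=> intf; elim: n => //= n; exact: int1_kernel_op. Qed.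

Lemma Rintegral_markov f : int1 f -> \int[mu]_x A f x = \int[mu]_x f x.
Proof.
move=> intf.
have intc : int1 (fun=> 1) by apply: (@bounded_integrable01 _ _ 1) => // x; rewrite normr1.
have := kernel_op_swap bq intf intc.
under eq_Rintegral do rewrite mul1r.
move=> ->; apply: eq_Rintegral01 => y Iy; rewrite /kernel_op.
by under eq_Rintegral do rewrite mulr1; rewrite q_mass// mulr1.
Qed.

(** Since [q] is nonnegative, the absolute value of [A f] is at most [A] applied to that of [f], and
    [A] preserves integrals. *)
Lemma norm1_markov f : int1 f -> norm1 mu (A f) <= norm1 mu f.
Proof.
move=> intf.
have intfn : int1 (fun x => `|f x|) by exact: integrable_norm.
rewrite /norm1 -(Rintegral_markov intfn); apply: le_Rintegral => //.
- by apply: integrable_norm => //; exact: int1_kernel_op.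
- exact: int1_kernel_op.
- move=> x _; rewrite /A /kernel_op.
  apply: le_trans (le_normr_Rintegral _ (integrable_kernel bq x intf)) _ => //.
  apply: le_Rintegral => //.
  + exact: (integrable_norm (integrable_kernel bq x intf)).
  + exact: (integrable_kernel bq x intfn).
  + by move=> y _; rewrite normrM (ger0_norm (q_ge0 _ _)).
Qed.

Lemma norm1_iter n f : int1 f -> norm1 mu (iter n A f) <= norm1 mu f.
Proof.
move=> intf; elim: n => //= n; apply: le_trans.
by apply: norm1_markov; exact: int1_iter.
Qed.

Lemma meanzero_kernel_op f : meanzero f -> meanzero (A f).
Proof. by move=> [intf f0]; split; [exact: int1_kernel_op|rewrite Rintegral_markov]. Qed.

Lemma meanzero_iter n f : meanzero f -> meanzero (iter n A f).
Proof. by move=> f0; elim: n => //= n; exact: meanzero_kernel_op. Qed.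

(** The bound depends on [f] only through its L^1 norm: this smoothing lets one grid interpolate all
    [A f] at once. *)
Lemma kernel_op_lip f x x' : int1 f -> I x -> I x' ->
  `|A f x - A f x'| <= C * `|x - x'| * norm1 mu f.
Proof.
move=> intf Ix Ix'.
have intfn : int1 (fun x => `|f x|) by exact: integrable_norm.
have ix := integrable_kernel bq x intf; have ix' := integrable_kernel bq x' intf.
rewrite /A /kernel_op -RintegralB//.
have iB : int1 (fun y => q x y * f y - q x' y * f y).
  by have := integrableB measurableT ix ix'.
apply: le_trans (le_normr_Rintegral _ iB) _ => //.
rewrite /norm1 -RintegralZl//; apply: le_Rintegral => //.
- exact: integrable_norm.
- exact: integrableRZl.
- by move=> y _; rewrite -mulrBl normrM ler_wpM2r// q_lip.
Qed.

Lemma iter_kernel_opD n f g : int1 f -> int1 g ->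
  iter n A (fun x => f x + g x) = (fun x => iter n A f x + iter n A g x).
Proof.
move=> intf intg; elim: n => //= n ->; apply/funext => x.
by rewrite /A (kernel_opD bq)//; exact: int1_iter.
Qed.

Lemma iter_kernel_opZ n f a : int1 f -> iter n A (fun x => a * f x) = (fun x => a * iter n A f x).
Proof.
move=> intf; elim: n => //= n ->; apply/funext => x.
by rewrite /A (kernel_opZ bq)//; exact: int1_iter.
Qed.

Lemma int1D f g : int1 f -> int1 g -> int1 (fun x => f x + g x).
Proof. by move=> intf intg; have := integrableD measurableT intf intg. Qed.

Lemma norm1D f g : int1 f -> int1 g ->
  norm1 mu (fun x => f x + g x) <= norm1 mu f + norm1 mu g.
Proof.
move=> intf intg.
have intfn : int1 (fun x => `|f x|) by exact: integrable_norm.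
have intgn : int1 (fun x => `|g x|) by exact: integrable_norm.
rewrite /norm1 -RintegralD//; apply: le_Rintegral => //.
- by apply: integrable_norm => //; exact: int1D.
- exact: int1D.
- by move=> x _; exact: ler_normD.
Qed.

Lemma norm1Z f a : int1 f -> norm1 mu (fun x => a * f x) = `|a| * norm1 mu f.
Proof.
move=> intf; rewrite /norm1 -RintegralZl//; last exact: integrable_norm.
by apply: eq_Rintegral => x _; rewrite normrM.
Qed.

(** Smallness of the iterates on finitely many functions passes, uniformly, to all their
    combinations with bounded coefficients. *)
Lemma iter_sum_bound n (N : nat) (a : 'I_N -> R) (psi : 'I_N -> R -> R) (M e : R) :
  0 <= M -> (forall j, int1 (psi j)) -> (forall j, `|a j| <= M) ->
  (forall j, norm1 mu (iter n A (psi j)) <= e) ->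
  int1 (fun x => \sum_(j < N) a j * psi j x) /\
  norm1 mu (iter n A (fun x => \sum_(j < N) a j * psi j x)) <= M * e *+ N.
Proof.
move=> M0; elim: N a psi => [|N IH] a psi ipsi aM psie.
  (* The zero function is written as a multiple so that [iter_kernel_opZ] computes its iterates. *)
  have -> : (fun x => \sum_(j < 0) a j * psi j x) = (fun x : R => 0 * 0).
    by apply/funext => x; rewrite big_ord0 mulr0.
  have i0 : int1 (fun=> 0) by apply: (@bounded_integrable01 _ _ 0) => // x; rewrite normr0.
  split; first exact: integrableRZl.
  by rewrite (iter_kernel_opZ _ _ i0) norm1Z ?normr0 ?mul0r//; exact: int1_iter.
have -> : (fun x => \sum_(j < N.+1) a j * psi j x) =
  (fun x => a ord0 * psi ord0 x + \sum_(j < N) a (lift ord0 j) * psi (lift ord0 j) x).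
  by apply/funext => x; rewrite big_ord_recl.
have [IH1 IH2] := IH (fun j => a (lift ord0 j)) (fun j => psi (lift ord0 j))
  (fun j => ipsi _) (fun j => aM _) (fun j => psie _).
have i0 : int1 (fun x => a ord0 * psi ord0 x) by exact: integrableRZl.
split; first exact: int1D.
rewrite iter_kernel_opD// mulrS.
apply: le_trans (norm1D _ _) _; [exact: int1_iter|exact: int1_iter|].
rewrite lerD// iter_kernel_opZ// norm1Z; last exact: int1_iter.
by apply: ler_pM => //; rewrite /norm1 Rintegral_ge0.
Qed.

(* A f is within C / N * norm1 f of the step function interpolating it at the j / N,
   which lies in a fixed finite-dimensional space where the iterates tend to 0. *)
Lemma iter_contraction :
  (forall g : R -> R, measurable_fun setT g -> (forall x, `|g x| <= 1) -> \int[mu]_x g x = 0 ->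
    norm1 mu (iter n A g) @[n --> \oo] --> (0 : R)) ->
  exists n, forall f, meanzero f -> norm1 mu (iter n A f) <= 2^-1 * norm1 mu f.
Proof.
move=> A1.
(* The mesh 1/N is chosen so that twice the interpolation error, [2 * C / N], is at most 1/4. *)
pose N := (Num.truncn (8 * C)).+1.
have N0 : 0 < N%:R :> R by rewrite ltr0n.
have CN : 8 * C <= N%:R by apply/ltW/truncnS_gt.
(* There are N+1 half-open intervals: the last one starts at 1 and catches the end point. *)
pose J (j : 'I_N.+1) : set R := `[j%:R / N%:R, j.+1%:R / N%:R[%classic.
have mJ j : measurable (J j) by exact: measurable_itv.
pose m j : R := \int[mu]_x \1_(J j) x.
have i1 j : int1 (\1_(J j) : R -> R).
  apply: (@bounded_integrable01 _ _ 1); first exact: measurable_indic.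
  by move=> x; rewrite indicE normr_nat lern1 leq_b1.
have m01 j : 0 <= m j <= 1.
  rewrite /m Rintegral_ge0//= -[leRHS]Rintegral_cst01.
  apply: le_Rintegral => //.
  by apply: (@bounded_integrable01 _ _ 1) => // x; rewrite normr1.
(* The indicators are centred, because the convergence hypothesis concerns mean-zero functions
   only. *)
pose psi j x : R := \1_(J j) x - m j.
have ic (c : R) : int1 (fun=> c) by apply: (@bounded_integrable01 _ _ `|c|).
have ipsi j : int1 (psi j) by have := integrableB measurableT (i1 j) (ic (m j)).
have psi0 j : \int[mu]_x psi j x = 0.
  rewrite /psi (RintegralB measurableT (i1 j) (ic (m j))).
  by rewrite Rintegral_cst01 subrr.
have psi_cvg j : norm1 mu (iter n A (psi j)) @[n --> \oo] --> (0 : R).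
  apply: A1 => //.
  - by apply: measurable_funB => //; exact: measurable_indic.
  - move=> x; rewrite /psi indicE; have /andP[? ?] := m01 j.
    by case: (x \in J j); rewrite /= ler_norml; apply/andP; split; lra.
(* The N+1 coefficients are at most [K * norm1 f], so the iterated combination contributes at most K
   / (4 (K + 1)) times [norm1 f]. *)
pose e := 4^-1 / (N.+1%:R * (K + 1)).
have K1 : 0 < K + 1 by rewrite ltr_wpDl.
have e0 : 0 < e by rewrite divr_gt0// mulr_gt0.
have : \forall n \near \oo, forall j, norm1 mu (iter n A (psi j)) <= e.
  apply: filter_forall => j.
  have := psi_cvg j => /cvgr0_norm_le /(_ e e0).
  by apply: filterS => n; exact: le_trans (ler_norm _).
move=> [n _ /(_ n (leqnn n)) psie].
(* The first application of [A] smooths [f], the other [n] shrink the interpolant of [A f]. *)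
exists n.+1 => f [intf f0].
have iAf := int1_kernel_op intf.
have nf0 : 0 <= norm1 mu f by rewrite /norm1 Rintegral_ge0.
pose a (j : 'I_N.+1) := A f (j%:R / N%:R).
have aM j : `|a j| <= K * norm1 mu f by exact: (kernel_op_bound bq).
have [iS Sbound] := @iter_sum_bound n N.+1 a psi (K * norm1 mu f) e
  (mulr_ge0 K0 nf0) ipsi aM psie.
set S := (fun x => _) in iS Sbound.
pose E x := \sum_(j < N.+1) a j * \1_(J j) x.
pose c0 := \sum_(j < N.+1) a j * m j.
have SE x : S x = E x - c0.
  by rewrite /S /E /c0 -sumrB; apply: eq_bigr => j _; rewrite -mulrBr.
have iE : int1 E.
  have -> : E = (fun x => S x + c0) by apply/funext => x; rewrite SE subrK.
  by apply: int1D => //; exact: ic.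
have S0 : \int[mu]_x S x = 0.
  rewrite /Rintegral; under eq_integral do rewrite /S -sumEFin.
  rewrite integral_sum//; last by move=> j; exact: integrableRZl.
  rewrite big1// => j _.
  have /= := RintegralZl (a j) measurableT (ipsi j).
  rewrite psi0 mulr0 /Rintegral => h; apply/eqP; rewrite -(@fineK _ (integral _ _ _)) ?h//.
  exact: (integrable_fin_num measurableT (integrableRZl (a j) (ipsi j))).
have iEA : int1 (fun x => E x - A f x) by have := integrableB measurableT iE iAf.
(* As [A f] has mean zero, the mean [c0] of the interpolant is itself an interpolation error; hence
   the factor 2 in [nr]. *)
have c0E : c0 = \int[mu]_x (E x - A f x).
  rewrite (RintegralB measurableT iE iAf) Rintegral_markov// f0 subr0.
  have -> : E = (fun x => S x + c0) by apply/funext => x; rewrite SE subrK.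
  by rewrite (RintegralD measurableT iS (ic c0)) S0 add0r Rintegral_cst01.
have EA x : I x -> `|E x - A f x| <= C / N%:R * norm1 mu f.
  move=> Ix; have /andP[x0 x1] : 0 <= x <= 1 by move: Ix; rewrite /= in_itv.
  have Nx0 : 0 <= N%:R * x by rewrite mulr_ge0// ltW.
  have /andP[jx xj] := truncn_itv Nx0.
  set j := Num.truncn (N%:R * x) in jx xj.
  have jN : (j < N.+1)%N.
    rewrite ltnS -(ler_nat R); apply: (le_trans jx); rewrite -[leRHS]mulr1 ler_wpM2l// ltW//.
  pose jo := Ordinal jN.
  have -> : E x = a jo.
    have xJ : x \in J jo.
      by rewrite inE /J/= in_itv/= ler_pdivrMr// ltr_pdivlMr// mulrC jx.
    rewrite /E (bigD1 jo)//= indicE xJ mulr1 big1 ?addr0// => i ij.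
    rewrite indicE memNset ?mulr0// /J/= in_itv/= ler_pdivrMr// ltr_pdivlMr// mulrC.
    move=> /andP[ix xi]; move/eqP : ij; apply; apply/val_inj => /=; apply/eqP.
    rewrite eqn_leq -ltnS -(ltr_nat R) (le_lt_trans ix xj) /=.
    by rewrite -ltnS -(ltr_nat R) (le_lt_trans jx xi).
  have Ij : I (j%:R / N%:R).
    by rewrite /= in_itv/= divr_ge0// ler_pdivrMr// mul1r ler_nat -ltnS jN.
  apply: le_trans (kernel_op_lip intf Ij Ix) _.
  rewrite ler_wpM2r// ler_wpM2l//.
  have jNx : j%:R / N%:R <= x by rewrite ler_pdivrMr// mulrC.
  have xjN : x <= j%:R / N%:R + N%:R^-1.
    by rewrite -[X in _ + X]mul1r -mulrDl natr1 ler_pdivlMr// mulrC ltW.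
  by rewrite distrC ger0_norm ?subr_ge0// lerBlDl.
have nr : norm1 mu (fun x => A f x - S x) <= 2 * (C / N%:R * norm1 mu f).
  apply: norm1_le01.
    by have := integrableB measurableT iAf iS.
  move=> x Ix.
  have -> : A f x - S x = - (E x - A f x) + c0 by rewrite SE; ring.
  have c0b : `|c0| <= C / N%:R * norm1 mu f.
    rewrite c0E; apply: le_trans (le_normr_Rintegral _ iEA) _ => //.
    exact: norm1_le01.
  apply: le_trans (ler_normD _ _) _; rewrite normrN.
  by have := EA x Ix; lra.
rewrite iterSr.
have -> : A f = (fun x => (A f x - S x) + S x) by apply/funext => x; rewrite subrK.
have irS : int1 (fun x => A f x - S x) by have := integrableB measurableT iAf iS.
rewrite iter_kernel_opD//.
apply: le_trans (norm1D _ _) _; [exact: int1_iter|exact: int1_iter|].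
have H1 := le_trans (norm1_iter n irS) nr.
have CN4 : 2 * (C / N%:R * norm1 mu f) <= 4^-1 * norm1 mu f.
  rewrite mulrA ler_wpM2r// mulrA ler_pdivrMr//; lra.
have Ke : K * norm1 mu f * e *+ N.+1 <= 4^-1 * norm1 mu f.
  rewrite -mulr_natr /e.
  have -> : K * norm1 mu f * (4^-1 / (N.+1%:R * (K + 1))) * N.+1%:R =
    4^-1 * norm1 mu f * (K / (K + 1)).
    by field; rewrite gt_eqF//= gt_eqF// ltr0n.
  rewrite -[leRHS]mulr1 ler_wpM2l//; first by rewrite mulr_ge0.
  by rewrite ler_pdivrMr// mul1r lerDl.
by apply: le_trans (lerD H1 Sbound) _; lra.
Qed.

(** The solution is [v + w], where [w] sums the iterates from the first on. The term [v] is kept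
    apart because it is merely integrable, whereas [w] is bounded. Dominated convergence passes from
    [A (v + p N) = p N.+1] to the limit at every point. *)
Lemma neumann v : (exists n, forall f, meanzero f -> norm1 mu (iter n A f) <= 2^-1 * norm1 mu f) ->
  meanzero v ->
  exists u : R -> R, [/\ meanzero u, forall x, u x - A u x = v x &
    exists M, forall x, `|u x - v x| <= M].
Proof.
move=> [n0 contr] v0.
pose a k := norm1 mu (iter k A v).
have a0 k : 0 <= a k by rewrite /a /norm1 Rintegral_ge0.
have ah k : a (k + n0)%N <= 2^-1 * a k.
  by rewrite /a addnC iterD; apply: contr; exact: meanzero_iter.
pose s N := \sum_(0 <= k < N) a k.
have s_nd : {homo s : n m / (n <= m)%N >-> n <= m}.
  by apply/nondecreasing_seqP => n; rewrite /s big_nat_recr//= lerDl.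
have s0 N : 0 <= s N by rewrite sumr_ge0.
(* Beyond the first [n0] terms, each term is at most half of an earlier one, so
   [s (N + n0) <= s n0 + s N / 2]; monotonicity of [s] concludes. *)
have sB N : s N <= 2 * s n0.
  have H : s (N + n0)%N <= s n0 + 2^-1 * s N.
    rewrite /s addnC (big_cat_nat (n := n0))//=; last exact: leq_addr.
    rewrite lerD2l -{1}[n0]add0n big_addn addnC addnK mulr_sumr.
    by apply: ler_sum => k _.
  by have := s_nd _ _ (leq_addr n0 N); lra.
pose B := K * (2 * s n0).
have [intv v00] := v0.
have itv k : int1 (iter k A v) by exact: int1_iter.
have bnd k x : `|iter k.+1 A v x| <= K * a k.
  exact: (kernel_op_bound bq x (itv k)).
pose p N x := \sum_(0 <= k < N) iter k.+1 A v x.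
have pB N x : \sum_(0 <= k < N) `|iter k.+1 A v x| <= B.
  apply: (@le_trans _ _ (K * s N)); last by rewrite ler_wpM2l.
  by rewrite /s mulr_sumr; apply: ler_sum => k _.
have p_cvg x : cvgn (p ^~ x).
  apply: (@normed_cvg _ R^o (fun k => iter k.+1 A v x)).
  have nd : {homo (fun N => \sum_(0 <= k < N) `|iter k.+1 A v x|) : n m / (n <= m)%N >-> n <= m}.
    by apply/nondecreasing_seqP => n; rewrite big_nat_recr//= lerDl.
  apply: (nondecreasing_is_cvgn nd).
  by exists B => _ [N _ <-]; exact: pB.
pose w x := limn (p ^~ x).
have pw x : p n x @[n --> \oo] --> w x by exact: p_cvg.
have pNB N x : `|p N x| <= B by apply: le_trans (ler_norm_sum _ _ _) _; exact: pB.
have wB x : `|w x| <= B.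
  rewrite ler_norml; apply/andP; split; [apply: limr_ge|apply: limr_le] => //;
    by near=> n; have := pNB n x; rewrite ler_norml => /andP[].
have pS N x : p N.+1 x = p N x + iter N.+1 A v x by rewrite /p big_nat_recr.
have vpS N : (fun x => v x + p N.+1 x) = (fun x => (v x + p N x) + iter N.+1 A v x).
  by apply/funext => x; rewrite pS addrA.
have vp0 : (fun x => v x + p 0 x) = v.
  by apply/funext => x; rewrite /p big_geq// addr0.
have mz N : meanzero (fun x => v x + p N x).
  elim: N => [|N [IH1 IH2]]; first by rewrite vp0.
  have [iN N0] := meanzero_iter N.+1 v0.
  rewrite vpS; split; first exact: int1D.
  by rewrite (RintegralD measurableT IH1 iN) IH2 N0 addr0.
have Ap N x : A (fun y => v y + p N y) x = p N.+1 x.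
  elim: N => [|N IH]; first by rewrite vp0 /p big_nat1.
  have [IH1 _] := mz N; have [iN _] := meanzero_iter N.+1 v0.
  by rewrite vpS pS /A (kernel_opD bq)// -/A IH.
have vp_cvg x : v x + p n x @[n --> \oo] --> v x + w x.
  by apply: (@cvgD _ R^o); [exact: cvg_cst|exact: pw].
have mvp N : measurable_fun setT (fun x => v x + p N x).
  by have [/integrableP[/measurable_EFinP]] := mz N.
have intvB : int1 (fun x => `|v x| + B).
  apply: int1D; first exact: integrable_norm.
  by apply: (@bounded_integrable01 _ _ `|B|).
have vpB n x : `|v x + p n x| <= `|v x| + B.
  by rewrite (le_trans (ler_normD _ _))// lerD2l.
have [iu lim_u] := @cvg_Rintegral_dominated _ TR R mu _ _ _ mvp intvB vp_cvg vpB.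
exists (fun x => v x + w x); split.
- split => //; rewrite -(cvg_lim (@Rhausdorff R) lim_u); apply: cvg_lim => //.
  rewrite (_ : (fun n => _) = fun=> 0); first exact: cvg_cst.
  by apply/funext => n; case: (mz n).
- move=> x; suff -> : A (fun x => v x + w x) x = w x by rewrite addrK.
  have mqx : measurable_fun setT (q x).
    by case: bq => mq _; exact: (measurableT_comp mq (pair1_measurable x)).
  have qK y : `|q x y| <= K by case: bq.
  have intqB : int1 (fun y => K * (`|v y| + B)) by exact: integrableRZl.
  have mqf n : measurable_fun setT (fun y => q x y * (v y + p n y)).
    exact: (measurable_funM mqx (mvp n)).
  have cvq y : q x y * (v y + p n y) @[n --> \oo] --> q x y * (v y + w y).
    by apply: cvgM; [exact: cvg_cst|exact: vp_cvg].
  have qvB n y : `|q x y * (v y + p n y)| <= K * (`|v y| + B) by rewrite normrM ler_pM.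
  have [_ limA] := @cvg_Rintegral_dominated _ TR R mu _ _ _ mqf intqB cvq qvB.
  rewrite /A /kernel_op -(cvg_lim (@Rhausdorff R) limA); apply: cvg_lim => //.
  rewrite (_ : (fun n => _) = (fun n => p n.+1 x)); last by apply/funext => n; exact: Ap.
  by rewrite (cvg_shiftS (p ^~ x)).
- by exists B => x; rewrite addrC addKr.
Unshelve. all: by end_near. Qed.
End markov_kernel01.

(** * Square-integrable functions *)

#[local] Instance leb01_ae_filter (R : realType) :
  Filter (nbhs (almost_everywhere (leb01 R))).
Proof. exact: ae_filter_ringOfSetsType. Qed.

Section L2_01.
Context {R : realType}.
Local Notation mu := (leb01 R).
Local Notation int1 f := (mu.-integrable setT (EFin \o f)).
Implicit Types (f g : R -> R).

Lemma ae_eq_Rintegral01 f g : measurable_fun setT f -> measurable_fun setT g ->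
  f = g %[ae mu] -> \int[mu]_x f x = \int[mu]_x g x.
Proof.
move=> mf mg fg; congr fine; apply: ae_eq_integral => //.
- exact/measurable_EFinP.
- exact/measurable_EFinP.
- by move: fg; apply: filterS => x fgx _; rewrite fgx.
Qed.

Lemma L2P f : L2 f <-> measurable_fun setT f /\ int1 (fun x => f x ^+ 2).
Proof.
rewrite /L2/=; split => [Lf|[mf intf]].
  split; first by have /sub_Lfun_mfun := Lf; rewrite inE.
  exact: Lfun2_integrable_sqr.
rewrite inE; apply/andP; split; rewrite inE//= /finite_norm unlock.
rewrite poweR_lty//.
have -> : (\int[mu]_x `|(EFin \o f) x| `^ 2 = \int[mu]_x `|(EFin \o (fun x => f x ^+ 2)%R) x|)%E.
  apply: eq_integral => x _ /=.
  by rewrite powR_mulrn// normrX.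
by have /integrableP[] := intf.
Qed.

Lemma L2_measurable f : L2 f -> measurable_fun setT f.
Proof. by move/L2P => []. Qed.

Lemma L2_mul_integrable f g : L2 f -> L2 g -> int1 (fun x => f x * g x).
Proof. by move=> Lf Lg; apply/Lfun1_integrable; exact: Lfun2_mul_Lfun1. Qed.

Lemma L2_bounded (M : R) f : measurable_fun setT f -> (forall x, `|f x| <= M) -> L2 f.
Proof.
move=> mf fM; apply/L2P; split => //.
apply: (@bounded_integrable01 _ _ (M ^+ 2)).
  exact: measurable_funX.
by move=> x; rewrite normrX lerXn2r// nnegrE ?normr_ge0// (le_trans _ (fM x)).
Qed.

Lemma L2_integrable f : L2 f -> int1 f.
Proof.
move=> Lf; have L1 : L2 (fun=> 1 : R) by apply: (@L2_bounded 1) => // x; rewrite normr1.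
have := L2_mul_integrable Lf L1.
by rewrite (_ : (fun x => f x * 1) = f)//; apply/funext => x; rewrite mulr1.
Qed.

Lemma norm2_ge0 f : 0 <= norm2 f.
Proof. by rewrite /norm2 fine_ge0// Lnorm_ge0. Qed.

Lemma norm2E f : L2 f -> norm2 f ^+ 2 = \int[mu]_x (f x ^+ 2).
Proof.
move=> Lf.
have Nfin : ('N[mu]_(2%:E)[EFin \o f] \is a fin_num)%E.
  rewrite ge0_fin_numE ?Lnorm_ge0//.
  by have /sub_Lfun_finLfun := Lf; rewrite inE.
have n2 : 2 != 0 :> R by rewrite pnatr_eq0.
have := poweR_Lnorm mu (EFin \o f) n2.
rewrite -(fineK Nfin) -/(norm2 f) /= powR_mulrn ?norm2_ge0// => /(congr1 fine) /= ->.
congr fine; apply: eq_integral => x _ /=.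
by rewrite powR_mulrn// real_normK// num_real.
Qed.

(** On a space of mass 1 this is the nonnegativity of the variance of the absolute value of [f],
    whose mean is [m]. *)
Lemma norm1_le_norm2 f : L2 f -> norm1 mu f <= norm2 f.
Proof.
move=> Lf; have intf := L2_integrable Lf.
have intfn : int1 (fun x => `|f x|) by exact: integrable_norm.
have [mf intf2] := (L2P f).1 Lf.
rewrite -(@ler_pXn2r _ 2)// ?nnegrE ?norm2_ge0 ?Rintegral_ge0//.
rewrite norm2E//; set m := norm1 mu f.
have ic (c : R) : int1 (fun=> c) by apply: (@bounded_integrable01 _ _ `|c|).
have i1 : int1 (fun x => 2 * m * `|f x| - m ^+ 2).
  by have := integrableB measurableT (integrableRZl (2 * m) intfn) (ic (m ^+ 2)).
have -> : m ^+ 2 = \int[mu]_x (2 * m * `|f x| - m ^+ 2).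
  rewrite (RintegralB measurableT (integrableRZl (2 * m) intfn) (ic (m ^+ 2))).
  rewrite RintegralZl// -/(norm1 mu f) -/m Rintegral_cst01; ring.
apply: le_Rintegral => // x _.
rewrite -subr_ge0 -[X in X - _]real_normK ?num_real//.
by rewrite (_ : _ - _ = (`|f x| - m) ^+ 2) ?sqr_ge0//; ring.
Qed.

Lemma L2Z a f : L2 f -> L2 (fun x => a * f x).
Proof.
move=> /L2P[mf intf]; apply/L2P; split; first exact: measurable_funM.
rewrite (_ : (fun x => _) = (fun x => a ^+ 2 * f x ^+ 2)); first exact: integrableRZl.
by apply/funext => x; rewrite exprMn.
Qed.

Lemma norm2_eq0_ae f : L2 f -> \int[mu]_x (f x ^+ 2) = 0 -> f = cst 0 %[ae mu].
Proof.
move=> /L2P[mf intf] f0.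
have : (\int[mu]_x `|(f x ^+ 2)%:E| = 0)%E.
  rewrite norm1E//; congr EFin; rewrite -[RHS]f0.
  by apply: eq_Rintegral => x _; rewrite ger0_norm// sqr_ge0.
have m2 : measurable_fun setT (fun x => (f x ^+ 2)%:E).
  by apply/measurable_EFinP; exact: measurable_funX.
move/(ae_eq_integral_abs mu measurableT m2); apply: filterS => x /(_ I) /= [].
by move/eqP; rewrite sqrf_eq0 => /eqP.
Qed.

(** With [D = T + H / N], the integral of [D ^ 2] is 2 + 2/N times the inner product of [T] and [H].
    Its nonnegativity is the lower bound, and its vanishing is the equality case. *)
Lemma inner_unit_sphere_min (H T : R -> R) : L2 H -> 0 < norm2 H -> L2 T -> norm2 T = 1 ->
  - norm2 H <= \int[mu]_x (T x * H x) /\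
  (\int[mu]_x (T x * H x) <= - norm2 H -> T = (fun x => - (H x / norm2 H)) %[ae mu]).
Proof.
move=> LH N0 LT T1; set N := norm2 H.
have iTH := L2_mul_integrable LT LH.
have [mT iT] := (L2P T).1 LT; have [mH iH] := (L2P H).1 LH.
pose D x := T x + N^-1 * H x.
have DE x : D x ^+ 2 = T x ^+ 2 + (2 / N * (T x * H x) + (N ^+ 2)^-1 * H x ^+ 2).
  by rewrite /D; field; rewrite gt_eqF.
have iD2 : int1 (fun x => 2 / N * (T x * H x) + (N ^+ 2)^-1 * H x ^+ 2).
  by have := integrableD measurableT (integrableRZl (2 / N) iTH) (integrableRZl (N ^+ 2)^-1 iH).
have LD : L2 D.
  apply/L2P; split; first by apply: measurable_funD => //; exact: measurable_funM.
  rewrite (_ : (fun x => _) = (fun x => T x ^+ 2 + (2 / N * (T x * H x) + (N ^+ 2)^-1 * H x ^+ 2))).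
    by have := integrableD measurableT iT iD2.
  by apply/funext => x; exact: DE.
have ID : \int[mu]_x (D x ^+ 2) = 2 + 2 / N * \int[mu]_x (T x * H x).
  under eq_Rintegral do rewrite DE.
  rewrite (RintegralD measurableT iT iD2).
  rewrite (RintegralD measurableT (integrableRZl (2 / N) iTH) (integrableRZl (N ^+ 2)^-1 iH)).
  rewrite !RintegralZl// -!norm2E// T1 -/N.
  by field; rewrite gt_eqF.
have ID0 : 0 <= \int[mu]_x (D x ^+ 2) by apply: Rintegral_ge0 => x _; exact: sqr_ge0.
have J0 : 0 <= N + \int[mu]_x (T x * H x).
  have : 0 <= N / 2 * \int[mu]_x (D x ^+ 2) by rewrite mulr_ge0// divr_ge0// ltW.
  rewrite ID (_ : N / 2 * _ = N + \int[mu]_x (T x * H x))//.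
  by field; rewrite gt_eqF.
split => [|JN]; first lra.
have JE : \int[mu]_x (T x * H x) = - N by apply/eqP; rewrite eq_le JN /=; lra.
have : \int[mu]_x (D x ^+ 2) = 0 by rewrite ID JE; field; rewrite gt_eqF.
move/(norm2_eq0_ae LD); apply: filterS => x Dx _.
have {}Dx : T x + N^-1 * H x = 0 by exact: Dx.
by rewrite /= [H x / N]mulrC; apply: (addIr (N^-1 * H x)); rewrite Dx addNr.
Qed.

Lemma unit_sphere_min (H : R -> R) : L2 H -> 0 < norm2 H ->
  let T x := - (H x / norm2 H) in
  [/\ L2 T, norm2 T = 1 & \int[mu]_x (T x * H x) = - norm2 H].
Proof.
move=> LH N0 T; set N := norm2 H in T *.
have TE : T = (fun x => - N^-1 * H x) by apply/funext => x; rewrite /T mulNr mulrC.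
have LT : L2 T by rewrite TE; exact: L2Z.
have [mH iH] := (L2P H).1 LH.
split => //.
- apply/eqP; rewrite -(@eqrXn2 _ 2)// ?norm2_ge0// norm2E// TE expr1n.
  under eq_Rintegral do rewrite exprMn.
  have Nn0 : N != 0 by rewrite gt_eqF.
  by rewrite RintegralZl// -norm2E// -/N sqrrN -exprMn mulVf// expr1n.
- rewrite TE; under eq_Rintegral do rewrite -mulrA -expr2.
  by rewrite RintegralZl// -norm2E// -/N expr2; field; rewrite gt_eqF.
Qed.
End L2_01.

(** * The response operator *)

Section linear_response.
Context {R : realType}.
Local Notation mu := (leb01 R).
Local Notation I := (`[0%R, 1%R]%classic : set R).
Local Notation int1 f := (mu.-integrable setT (EFin \o f)).
Context (T0 rho : R -> R) (Krho : R).
Context (mT0 : measurable_fun (`[0, 1] : set R) T0).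
Context (T0_01 : forall x, 0 <= x <= 1 -> 0 <= T0 x <= 1).
Context (rhoK : forall x y, `|rho x - rho y| <= Krho * `|x - y|).
Context (rho_ge0 : forall x, 0 <= rho x).
Context (rho_int1 : (\int[@lebesgue_measure R]_x (rho x)%:E = 1)%E).
Context (rho_supp : forall x, ~ (-1 <= x <= 1) -> rho x = 0).
Context (A1 : forall g, V g -> norm2 (iter n (L0 T0 rho) g) @[n --> \oo] --> (0 : R)).

Local Notation krn := (ker01 T0 rho).
Local Notation dkrn := (ker01 T0 (ae_derivative rho)).
Local Notation L := (kernel_op mu krn).

Let crho : continuous rho := lipschitz_bound_continuous rhoK.
Let drho_supp := ae_derivative_supp crho rho_supp.

Lemma krn_bounded : @bounded_kernel _ (measurableTypeR R) R (6 * (3 * Krho)) krn.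
Proof.
apply: ker01_bounded => //; first exact: continuous_measurable_fun.
exact: lipschitz_supp_bounded.
Qed.

Lemma dkrn_bounded : @bounded_kernel _ (measurableTypeR R) R (6 * Krho) dkrn.
Proof.
apply: ker01_bounded => //; first exact: measurable_ae_derivative.
by move=> x; exact: ae_derivative_bounded.
Qed.

Lemma krn_ge0 x y : 0 <= krn x y.
Proof. by rewrite /ker01 /fold6 mulr_ge0// ?mulr_ge0// !addr_ge0. Qed.

Lemma Rintegral_ker01 (g : R -> R) y : I y ->
  \int[mu]_x ker01 T0 g x y = \int[mu]_x fold6 g x (T0 y).
Proof.
move=> Iy; apply: eq_Rintegral01 => x Ix.
by rewrite /ker01 !indicE !mem_set// !mul1r patchE mem_set.
Qed.

Lemma krn_mass y : I y -> \int[mu]_x krn x y = 1.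
Proof.
move=> Iy; rewrite Rintegral_ker01// (fold6_density rhoK)//.
by apply: T0_01; move: Iy; rewrite /= in_itv.
Qed.

(** By telescoping only two values of [rho] remain, at [3 - T0 y >= 2] and [-3 - T0 y <= -3], off
    its support. *)
Lemma dkrn_mass y : I y -> \int[mu]_x dkrn x y = 0.
Proof.
move=> Iy; rewrite Rintegral_ker01// (fold6_FTC _ rhoK).
have /andP[t0 t1] : 0 <= T0 y <= 1 by apply: T0_01; move: Iy; rewrite /= in_itv.
by rewrite !rho_supp ?subrr// => /andP[]; lra.
Qed.

(** Both points are taken in [0,1], as the cut-off indicator may jump at the ends. *)
Lemma krn_lip x x' y : I x -> I x' -> `|krn x y - krn x' y| <= 6 * Krho * `|x - x'|.
Proof.
move=> Ix Ix'; rewrite /ker01 !indicE !(mem_set Ix) !(mem_set Ix') !mul1r -mulrBr normrM.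
rewrite -[leRHS]mul1r ler_pM//; last exact: fold6_lipschitz.
by rewrite normr_nat lern1 leq_b1.
Qed.

Lemma kernel_op01_eq (q : R -> R -> R) f g : (forall y, I y -> f y = g y) ->
  kernel_op mu q f = kernel_op mu q g.
Proof. by move=> fg; apply/funext => x; apply: eq_Rintegral01 => y /fg ->. Qed.

Lemma L0E f x : I x -> L0 T0 rho f x = L f x.
Proof. by move=> Ix; apply: eq_Rintegral01 => y Iy; rewrite /k0 ker01E. Qed.

Lemma iter_L0E n f x : I x -> iter n (L0 T0 rho) f x = iter n L f x.
Proof.
elim: n x => [//|n IH] x Ix.
rewrite -[LHS]/(L0 T0 rho (iter n (L0 T0 rho) f) x) (L0E _ Ix).
by rewrite (kernel_op01_eq krn IH).
Qed.

Lemma calGE f y : I y -> calG T0 rho f y = kernel_op mu (fun y x => dkrn x y) f y.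
Proof. by move=> Iy; apply: eq_Rintegral01 => x Ix; rewrite /kerP ker01E. Qed.

Lemma L2_kernel_op (K : R) (q : R -> R -> R) f :
  @bounded_kernel _ (measurableTypeR R) R K q -> int1 f -> L2 (kernel_op mu q f).
Proof.
move=> bq intf; apply: (@L2_bounded _ (K * norm1 mu f)).
  exact: (measurable_kernel_op bq intf).
by move=> x; exact: (kernel_op_bound bq x intf).
Qed.

Lemma L_contraction : exists n, forall f, int1 f /\ \int[mu]_x f x = 0 ->
  norm1 mu (iter n L f) <= 2^-1 * norm1 mu f.
Proof.
apply: (iter_contraction krn_bounded krn_ge0 krn_mass krn_lip) => g mg g1 g0.
have Lg : L2 g by exact: L2_bounded mg g1.
have LIg n : L2 (iter n L g).
  elim: n => //= n IH; apply: (L2_kernel_op krn_bounded); exact: L2_integrable.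
apply: (@squeeze_cvgr _ _ _ _ (cst 0) (fun n => norm2 (iter n (L0 T0 rho) g))).
(* On [0,1] the iterates of [L] are those of [L0], so the L^1 norm is squeezed under the L^2 norm
   controlled by (A1). *)
- near=> n; rewrite /norm1 Rintegral_ge0//=.
  rewrite (@eq_norm2 _ _ (iter n L g)); first exact: norm1_le_norm2.
  by move=> x Ix; exact: iter_L0E.
- exact: cvg_cst.
- exact: A1.
Unshelve. all: by end_near. Qed.

(** [neumann] only yields an integrable solution; it is square-integrable because both [u - v] and
    [v] are bounded. *)
Lemma id_sub_L0_surjective (M : R) (v : R -> R) : measurable_fun setT v ->
  (forall x, `|v x| <= M) -> \int[mu]_x v x = 0 ->
  exists u, V u /\ u \- L0 T0 rho u = v %[ae mu].
Proof.
move=> mv vM v0.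
have intv : int1 v by exact: bounded_integrable01 mv vM.
have [u [[intu u0] uv [B uB]]] :=
  neumann krn_bounded krn_mass L_contraction (conj intv v0).
exists u; split.
  split => //; apply: (@L2_bounded _ (B + M)).
    by have /integrableP[/measurable_EFinP] := intu.
  move=> x; rewrite -[u x](subrK (v x)) (le_trans (ler_normD _ _))// lerD//.
by apply: leb01_ae => x Ix _; rewrite /= L0E// uv.
Qed.

(** The transposed kernel shows that the set of candidates is nonempty, so [adjoint] returns a
    genuine one. *)
Lemma adjoint_L0P w : L2 w -> L2 (adjoint (L0 T0 rho) w) /\
  forall f, L2 f -> inner (L0 T0 rho f) w = inner f (adjoint (L0 T0 rho) w).
Proof.
move=> Lw; have intw := L2_integrable Lw.
rewrite /adjoint; set P := [set h | _].
apply: (@xgetPex _ (cst 0) P); exists (kernel_op mu (fun y x => krn x y) w); split.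
  exact: (L2_kernel_op (bounded_kernel_swap krn_bounded)).
move=> f Lf; have intf := L2_integrable Lf.
rewrite /inner -(kernel_op_swap krn_bounded intf intw).
by apply: eq_Rintegral01 => x Ix; rewrite L0E// mulrC.
Qed.

(** The measurable version of the function to which the inverse of Id - L_0 is applied in [Rhat];
    the two agree on [0,1]. *)
Definition response (f0 T : R -> R) := kernel_op mu dkrn (fun y => T y * f0 y).

Lemma response_mean0 f0 T : int1 (fun y => T y * f0 y) -> \int[mu]_x response f0 T x = 0.
Proof.
move=> intf.
have ic : int1 (fun=> 1) by apply: (@bounded_integrable01 _ _ 1) => // x; rewrite normr1.
have := kernel_op_swap dkrn_bounded intf ic.
under eq_Rintegral do rewrite mul1r.
move=> ->; rewrite (@eq_Rintegral01 _ _ (fun=> 0)) ?Rintegral_cst01// => y Iy.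
rewrite /kernel_op; under eq_Rintegral do rewrite mulr1.
by rewrite dkrn_mass// mulr0.
Qed.

(** The two minus signs cancel and leave <c, u> with u - L_0 u = v. Then <c, u> = <w, u> - <w, L_0
    u> = <w, v>, and swapping the kernel moves [w] under the transpose of [dkrn]. *)
Lemma objectiveE f0 c w T : L2 f0 -> L2 c -> L2 T -> L2 w ->
  w \- adjoint (L0 T0 rho) w = c %[ae mu] ->
  objective T0 rho f0 c T =
  \int[mu]_y (T y * (f0 y * kernel_op mu (fun y x => dkrn x y) w y)).
Proof.
move=> Lf0 Lc LT Lw wc.
have intTf := L2_mul_integrable LT Lf0.
have intw := L2_integrable Lw.
set v := response f0 T.
have mv : measurable_fun setT v by exact: (measurable_kernel_op dkrn_bounded intTf).
have vM x : `|v x| <= 6 * Krho * norm1 mu (fun y => T y * f0 y).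
  exact: (kernel_op_bound dkrn_bounded x intTf).
have [u0 [Vu0 u0v]] := id_sub_L0_surjective mv vM (response_mean0 intTf).
set v' := fun x => \int[mu]_y (kerP T0 rho x y * T y * f0 y).
have v'E x : I x -> v' x = v x.
  move=> Ix; apply: eq_Rintegral01 => y Iy.
  by rewrite -mulrA /kerP ker01E.
have u0v' : u0 \- L0 T0 rho u0 = v' %[ae mu].
  move: u0v (leb01_ae v'E); apply: filterS2 => x /= h1 h2 t.
  by rewrite h1// h2.
(* Since [u0] solves the equation, the choice operator returns a solution, possibly another one;
   what follows uses only its equation. *)
have [[Lu u_mean] uv'] : V (inv_id_sub V (L0 T0 rho) v') /\
    (inv_id_sub V (L0 T0 rho) v') \- L0 T0 rho (inv_id_sub V (L0 T0 rho) v') = v' %[ae mu].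
  by apply: (@xgetPex _ (cst 0) [set u | V u /\ u \- L0 T0 rho u = v' %[ae mu]]); exists u0.
rewrite /objective /Rhat -/v'; set u := inv_id_sub V _ _ in Lu u_mean uv' *.
have intu := L2_integrable Lu.
have Lau := adjoint_L0P Lw.
set aw := adjoint (L0 T0 rho) w in wc Lau; have [Law awP] := Lau.
have LLu : L2 (L u) by exact: (L2_kernel_op krn_bounded).
have Lv : L2 v by exact: L2_bounded mv vM.
have mL2 f : L2 f -> measurable_fun setT f := @L2_measurable R f.
transitivity (\int[mu]_x (c x * u x)).
  have -> : inner c (\- u) = \int[mu]_x (-1 * (c x * u x)).
    by apply: eq_Rintegral => x _ /=; ring.
  by rewrite (RintegralZl (-1) measurableT (L2_mul_integrable Lc Lu)) mulN1r opprK.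
transitivity (\int[mu]_x (w x * u x - u x * aw x)).
  apply: ae_eq_Rintegral01.
  - by apply: measurable_funM; exact: mL2.
  - by apply: measurable_funB; apply: measurable_funM; exact: mL2.
  - by move: wc; apply: filterS => x /= h t; rewrite -h//; ring.
rewrite (RintegralB measurableT (L2_mul_integrable Lw Lu) (L2_mul_integrable Lu Law)).
rewrite -[X in _ - X]/(inner u aw) -awP//.
have -> : inner (L0 T0 rho u) w = \int[mu]_x (w x * L u x).
  by apply: eq_Rintegral01 => x Ix; rewrite L0E// mulrC.
rewrite -(RintegralB measurableT (L2_mul_integrable Lw Lu) (L2_mul_integrable Lw LLu)).
transitivity (\int[mu]_x (w x * v x)).
  apply: ae_eq_Rintegral01.
  - by apply: measurable_funB; apply: measurable_funM; exact: mL2.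
  - by apply: measurable_funM; exact: mL2.
  - move: uv' (leb01_ae v'E) (leb01_ae (L0E u)); apply: filterS3 => x /= h1 h2 h3 t.
    by rewrite -mulrBr -h3 h1// h2.
rewrite (kernel_op_swap dkrn_bounded intTf intw).
by apply: eq_Rintegral => y _; rewrite mulrA.
Qed.

(** A fixed point inherits the smoothing of [L0] from L^1 to L^oo; this is the source of the
    boundedness of the optimum. *)
Lemma fixed_bounded f0 : L2 f0 -> L0 T0 rho f0 = f0 %[ae mu] ->
  exists M, {ae mu, forall x, `|f0 x| <= M}.
Proof.
move=> Lf0 fix0; exists (6 * (3 * Krho) * norm1 mu f0).
have bnd x : I x -> `|L0 T0 rho f0 x| <= 6 * (3 * Krho) * norm1 mu f0.
  by move=> Ix; rewrite L0E//; apply: (kernel_op_bound krn_bounded x); exact: L2_integrable.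
by move: fix0 (leb01_ae bnd); apply: filterS2 => x h1 h2; rewrite -h1.
Qed.
End linear_response.

(** * The optimal perturbation *)

Theorem theorem7p4 (R : realType) (T0 rho : R -> R)
  (mT0 : measurable_fun (`[0, 1] : set R) T0)
  (T0_01 : forall x, 0 <= x <= 1 -> 0 <= T0 x <= 1)
  (rho_lip : lipschitz rho)
  (rho_ge0 : forall x, 0 <= rho x)
  (rho_int1 : (\int[@lebesgue_measure R]_x (rho x)%:E = 1)%E)
  (rho_supp : forall x, ~ (-1 <= x <= 1) -> rho x = 0)
  (A1 : forall g, V g -> norm2 (iter n (L0 T0 rho) g) @[n --> \oo] --> (0 : R))
  (f0 : R -> R)
  (f0_L2 : L2 f0)
  (f0_fixed : L0 T0 rho f0 = f0 %[ae leb01 R])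
  (f0_int1 : \int[leb01 R]_x f0 x = 1)
  (l : R) (l_ge0 : 0 <= l)
  (c : R -> R) (c_perp : perp (span1 f0) c)
  (F'_ex : exists F' : set R,
    [/\ measurable F', F' `<=` Ftilde T0 l, (0 < leb01 R F')%E &
        forall y, F' y -> 0 < f0 y /\
          ~ perp (span1 (kerP T0 rho ^~ y)) (inv_id_sub_adjoint T0 rho f0 c)]) :
  let Tdot := Topt T0 rho l f0 c in
  [/\ is_minimizer (feasible T0 l) (objective T0 rho f0 c) Tdot,
      (forall T, is_minimizer (feasible T0 l) (objective T0 rho f0 c) T ->
         T = Tdot %[ae leb01 R]) &
      Tdot \in Lfun (leb01 R) +oo%E].
Proof.
move=> Tdot.
have [Krho rhoK] := lipschitzP rho_lip.
have [F' [mF' F'F F'0 F'w]] := F'_ex.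
have [y0 F'y0] : F' !=set0.
  by apply/set0P/eqP => F'E; move: F'0; rewrite F'E measure0 ltxx.
set w := inv_id_sub_adjoint T0 rho f0 c in F'w.
have [Lc _] := c_perp.
have [[Lw _] wc] : perp (span1 f0) w /\ w \- adjoint (L0 T0 rho) w = c %[ae leb01 R].
  rewrite /w /inv_id_sub_adjoint /inv_id_sub; set P := [set u | _].
  (* If w were a junk value, it would be 0, against the hypothesis on F'. *)
  have [exP|nexP] := pselect (exists u, P u); first exact: (xgetPex _ exP).
  exfalso; have [_] := F'w _ F'y0; apply.
  have -> : w = cst 0 by apply: xgetPN => u Pu; apply: nexP; exists u.
  split; first by apply: (@L2_bounded _ 0) => // x; rewrite normr0.
  move=> h _; rewrite /inner; under eq_Rintegral do rewrite mul0r.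
  by rewrite Rintegral_cst01.
have bdk := dkrn_bounded mT0 rhoK.
pose G := kernel_op (leb01 R) (fun y x => ker01 T0 (ae_derivative rho) x y) w.
have intw := L2_integrable Lw.
pose MG := 6 * Krho * norm1 (leb01 R) w.
have mG : measurable_fun setT G by exact: (measurable_kernel_op (bounded_kernel_swap bdk) intw).
have GM y : `|G y| <= MG by exact: (kernel_op_bound (bounded_kernel_swap bdk) y intw).
have GE y : 0 <= y <= 1 -> calG T0 rho w y = G y.
  by move=> y01; apply: (calGE T0_01 rhoK rho_supp); rewrite /= in_itv.
pose F := Ftilde T0 l.
have FI y : F y -> 0 <= y <= 1 by case.
have mF : measurable F.
  have -> : F = `[0, 1]%classic `&` T0 @^-1` `[l, 1 - l]%classic.
    by apply/seteqP; split => y /=; rewrite !in_itv/=.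
  by apply: mT0; exact: measurable_itv.
(* A feasible function vanishes off [F], so it sees the linear form only through this truncation. *)
pose H y := f0 y * G y * \1_F y.
have mH : measurable_fun setT H.
  apply: measurable_funM; last exact: measurable_indic.
  by apply: measurable_funM => //; exact: L2_measurable.
have indF y : `|\1_F y| <= 1 :> R by rewrite indicE normr_nat lern1 leq_b1.
have MG0 : 0 <= MG by exact: le_trans (normr_ge0 _) (GM 0).
have HM y : `|H y| <= `|f0 y| * MG.
  rewrite /H !normrM -[leRHS]mulr1 ler_pM ?mulr_ge0//.
  by rewrite ler_wpM2l.
have LH : L2 H.
  apply/L2P; split => //.
  have [_ if0] := (L2P f0).1 f0_L2.
  apply: le_integrable (integrableRZl (MG ^+ 2) if0) => //.
    by apply/measurable_EFinP; exact: measurable_funX.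
  move=> y _ /=; rewrite lee_fin [leLHS]normrX.
  have -> : `|MG ^+ 2 * f0 y ^+ 2| = (`|f0 y| * MG) ^+ 2.
    by rewrite normrM !normrX (ger0_norm MG0) -exprMn mulrC.
  by apply: (lerXn2r 2 _ _ (HM y)); rewrite nnegrE; [exact: normr_ge0|exact: mulr_ge0].
pose N := norm2 H.
have TdotE : Tdot = (fun y => - (H y / N)).
  have hE : (f0 \* calG T0 rho w) \* \1_F = H.
    apply/funext => y; rewrite /H /= !indicE; case: (boolP (y \in F)) => [/set_mem/FI/GE ->//|_].
    by rewrite !mulr0.
  apply/funext => y; rewrite /Tdot /Topt -/w -/F hE -/N; case: ifPn => yF.
    by rewrite -hE /= indicE yF mulr1.
  by rewrite -hE /= indicE (negbTE yF) mulr0 mul0r oppr0.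
(* If the norm were 0, [H] would vanish almost everywhere. But a zero of [H] in [F'] gives
   [G y = 0], as [f0 y > 0], making [w] orthogonal to the kernel at [y], which is excluded. So [F']
   would lie in a null set. *)
have N0 : 0 < N.
  rewrite lt_neqAle norm2_ge0 andbT; apply/eqP => N0.
  have /(norm2_eq0_ae LH) H0 : \int[leb01 R]_y (H y ^+ 2) = 0.
    by rewrite -norm2E// -/N -N0 expr0n.
  have [A [mA A0 HA]] := H0.
  have F'A : F' `<=` A.
    move=> y F'y; apply: HA => /= /(_ Logic.I) Hy0.
    have [f0y nperp] := F'w _ F'y; apply: nperp; split => // h [a ->].
    have Fy := F'F _ F'y.
    have Gy0 : G y = 0.
      move: Hy0; rewrite /H indicE mem_set// mulr1 => /eqP.
      by rewrite mulf_eq0 gt_eqF//= => /eqP.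
    rewrite /inner (@eq_Rintegral01 _ _ (fun x => a * (ker01 T0 (ae_derivative rho) x y * w x))).
      rewrite RintegralZl//; last exact: (integrable_kernel (bounded_kernel_swap bdk) y intw).
      by rewrite -[X in _ * X]/(G y) Gy0 mulr0.
    move=> x Ix; have Iy : `[0%R, 1%R]%classic y by rewrite /= in_itv/=; exact: FI.
    have drho_supp := ae_derivative_supp (lipschitz_bound_continuous rhoK) rho_supp.
    by rewrite /= /kerP (ker01E T0_01 drho_supp Ix Iy); ring.
  have : (leb01 R F' <= leb01 R A)%E by apply: le_measure; rewrite ?inE.
  by rewrite A0 leNgt F'0.
have JE T : L2 T -> {ae leb01 R, forall x, ~ F x -> T x = 0} ->
    objective T0 rho f0 c T = \int[leb01 R]_y (T y * H y).
  move=> LT TF.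
  rewrite (objectiveE mT0 T0_01 rhoK rho_ge0 rho_int1 rho_supp A1 f0_L2 Lc LT Lw wc).
  apply: ae_eq_Rintegral01.
  - apply: measurable_funM; first exact: L2_measurable.
    by apply: measurable_funM; [exact: L2_measurable|exact: mG].
  - by apply: measurable_funM; first exact: L2_measurable.
  - apply: filterS TF => y TFy _ /=; rewrite -/G /H indicE.
    case: (boolP (y \in F)) => [_|]; first by rewrite mulr1.
    by rewrite notin_setE => /TFy ->; rewrite !mul0r.
have [LTd nTd JTd] := unit_sphere_min LH N0.
rewrite -/N -TdotE in LTd nTd.
have Td_supp : {ae leb01 R, forall x, ~ F x -> Tdot x = 0}.
  apply: aeW => y nFy; rewrite TdotE /H indicE memNset// mulr0 mul0r oppr0//.
have Td_feas : feasible T0 l Tdot.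
  by split; [split|rewrite nTd expr1n subrr].
have feasP T : feasible T0 l T -> [/\ L2 T, {ae leb01 R, forall x, ~ F x -> T x = 0} & norm2 T = 1].
  move=> [[LT TF] T1]; split => //.
  by apply/eqP; rewrite -(@eqrXn2 _ 2)// ?norm2_ge0// expr1n -subr_eq0; apply/eqP.
have JTdE : objective T0 rho f0 c Tdot = - N.
  by rewrite JE// TdotE; exact: JTd.
split.
- split; first exact: Td_feas.
  move=> T /feasP[LT TF T1]; rewrite JTdE (JE T LT TF).
  by have [] := inner_unit_sphere_min LH N0 LT T1.
- move=> T [/feasP[LT TF T1] Tmin].
  (* Another minimizer does at least as well as [Tdot], whose value is -N, so the equality case
     applies. *)
  have := Tmin _ Td_feas; rewrite JTdE (JE T LT TF) => JT.
  have [_ H1] := inner_unit_sphere_min LH N0 LT T1.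
  by rewrite TdotE; exact: H1 JT.
- have [M f0M] := fixed_bounded mT0 T0_01 rhoK rho_supp f0_L2 f0_fixed.
  rewrite inE; apply/andP; split; rewrite inE; first exact: L2_measurable.
  rewrite /= /finite_norm unlock; case: ifPn => // _.
  (* The factors are the essential bound of [f0], the bound of [G] and the normalization. *)
  apply: (@le_lt_trans _ _ (M * MG / N)%:E); last by rewrite ltry.
  apply/ess_supP; apply: filterS f0M => y f0y.
  rewrite /= lee_fin TdotE normrN normrM normfV (gtr0_norm N0).
  rewrite ler_wpM2r ?invr_ge0 ?norm2_ge0// (le_trans (HM y))// ler_wpM2r//.
Qed.
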